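(* Let $n\ge 1$ and let $\mathcal N_1$ and $\mathcal N_2$ be two Grassmann necklaces in $\binom{[n]}{r}$ that are separated from each other, i.e. $X\|Y$ for every set $X$ in $\mathcal N_1$ and every set $Y$ in $\mathcal N_2$. Put $\mathcal I_k=\mathcal{I}nt(\mathcal N_k)$ and $\mathcal O_k=\mathcal{O}ut(\mathcal N_k)$ for $k=1,2$. Then the four systems $\mathcal I_1\cap\mathcal I_2$, $\mathcal I_1\cap\mathcal O_2$, $\mathcal O_1\cap\mathcal I_2$ and $\mathcal O_1\cap\mathcal O_2$ are pure, and the sum of their ranks is equal to $r(n-r)+1$.
   Context: $[n]=\{1,\ldots,n\}$, regarded as $\mathbb Z$ modulo $n$; $\binom{[n]}{r}$ is the set of $r$-element subsets of $[n]$. For $i\in[n]$, $<_i$ is the cyclically shifted order $i<_i i+1<_i\cdots<_i n<_i 1<_i\cdots<_i i-1$. For $X,Y\in\binom{[n]}{r}$, write $X\ll_i Y$ if $x<_i y$ for all $x\in X-Y$ and $y\in Y-X$. $X$ and $Y$ are (weakly) separated, written $X\|Y$, if $X\ll_j Y$ for some $j\in[n]$. A system $\mathcal X\subseteq\binom{[n]}{r}$ is separated if $X\|Y$ for all $X,Y\in\mathcal X$. A system $\mathcal D\subseteq\binom{[n]}{r}$ is pure if all inclusion-wise maximal separated subsystems of $\mathcal D$ have the same size; this size is called the rank of $\mathcal D$. A (Grassmann) necklace in $\binom{[n]}{r}$ is a family $\mathcal N=(N_1,\ldots,N_n)$ of sets in $\binom{[n]}{r}$ such that $N_{i+1}\supseteq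 N_i-\{i\}$ for each $i$ (indices modulo $n$). Standing assumption: $i\in N_i$ for every $i\in[n]$. The interior of $\mathcal N$ is $\mathcal{I}nt(\mathcal N)=\{X\in\binom{[n]}{r} : N_i\ll_i X \text{ for every } i\in[n]\}$. Put $\mathcal S(\mathcal N)=\{X\in\binom{[n]}{r} : X\|N_i \text{ for all } i\in[n]\}$. One has $\mathcal{I}nt(\mathcal N)\subseteq\mathcal S(\mathcal N)$, and the exterior of $\mathcal N$ is $\mathcal{O}ut(\mathcal N)=\mathcal S(\mathcal N)\setminus\mathcal{I}nt(\mathcal N)$. *)

(* Defs.v *)
From mathcomp Require Import all_boot.

Set Implicit Arguments.
Unset Strict Implicit.
Unset Printing Implicit Defensive.

(* The ground set [n] is 'I_n, i.e. {0, ..., n-1} instead of {1, ..., n}; the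
   cyclic successor is ordS. *)

Section Separation.

Variable n : nat.
Implicit Types (i j x y : 'I_n) (X Y : {set 'I_n}).

(* x + (n - i) mod n is the position of x in the list i, i+1, ..., i-1. *)
Definition cyc_lt i x y : bool := (x + (n - i)) %% n < (y + (n - i)) %% n.

(* X <<_i Y *)
Definition cyc_before i X Y : bool :=
  [forall x in X :\: Y, forall y in Y :\: X, cyc_lt i x y].

(* X || Y *)
Definition separated X Y : bool := [exists j, cyc_before j X Y].

Definition separated_system (A : {set {set 'I_n}}) : bool :=
  [forall X in A, forall Y in A, separated X Y].

Definition max_separated_in (D A : {set {set 'I_n}}) : bool :=
  maxset (fun B : {set {set 'I_n}} => (B \subset D) && separated_system B) A.

Definition pure (D : {set {set 'I_n}}) : Prop :=
  forall A B, max_separated_in D A -> max_separated_in D B -> #|A| = #|B|.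

(* For pure D this is the common size of the maximal separated subsystems,
   see rank_pure. *)
Definition rank (D : {set {set 'I_n}}) : nat :=
  \max_(A : {set {set 'I_n}} | max_separated_in D A) #|A|.

Lemma rank_pure D A : pure D -> max_separated_in D A -> rank D = #|A|.
Proof.
move=> pD mA; apply/eqP; rewrite eqn_leq; apply/andP; split.
  by apply/bigmax_leqP => B mB; rewrite (pD _ _ mB mA).
exact: (leq_bigmax_cond (F := fun B : {set {set 'I_n}} => #|B|)).
Qed.

End Separation.

Section Necklaces.

Variables n r : nat.
Implicit Type N : 'I_n -> {set 'I_n}.

(* The first clause is the normalization i \in N_i. *)
Definition necklace N : Prop :=
  [/\ forall i, i \in N i,
      forall i, #|N i| = r
    & forall i, N i :\ i \subset N (ordS i)].

Definition interior N : {set {set 'I_n}} :=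
  [set X : {set 'I_n} | (#|X| == r) && [forall i, cyc_before i (N i) X]].

Definition separated_from N : {set {set 'I_n}} :=
  [set X : {set 'I_n} | (#|X| == r) && [forall i, separated X (N i)]].

Definition exterior N : {set {set 'I_n}} := separated_from N :\: interior N.

End Necklaces.

(* Main.v *)
(* The union of maximal separated subsystems of the four pieces is separated, and it is a maximal
   separated system of r-sets. All of the latter have r(n-r)+1 members; varying one piece at a
   time gives purity, and counting the union gives the sum of the ranks.

   X in Int(N) and Y in Out(N) are separated: call i good if N_i <<_i Y, and cut the circle into a
   maximal run of bad indices and its complementary arc. On the run the elements of X-Y come
   before those of Y-X, on the arc they come after them, so X and Y do not cross.

   Size of a maximal system C of r-sets: pass from the traces X /\ [0,j) to the traces
   X /\ [0,j]. Their number grows by the number of P such that P and P+j both are traces. Such P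
   are determined by |P|, and the sizes k that occur are those with k < r and k <= j < n-r+k.
   To find a P of given size, start at the pair of intervals K+j, K+c at j and move through pairs
   of this kind in C by the following flip, which increases 2 * sum(K) + c.

   Flip: if C contains K+a and K+b, then C contains K+x for some x in the arc (a,b) or K+a+b-y
   for some y in the arc (b,a), unless there are no candidates x, y at all. By maximality, if this
   fails then every candidate is blocked by a member of C. In a minimal counterexample to the
   combinatorial version of this, where only some candidates are live, deleting w frees another
   candidate nx(w), so every set blocking nx(w) depends on w. Iterates of nx move monotonically along an
   arc, exits of the two arcs are matched by an order-reversing map, hence there is a cycle of two
   monotone runs; the blocking sets along these runs would have to cross. *)

Require Import Defs.
From mathcomp Require Import all_boot zify.

Set Implicit Arguments.
Unset Strict Implicit.
Unset Printing Implicit Defensive.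

(** * Blocked candidates on two arcs *)

Definition ltd (e : bool) (i j : nat) : bool := if e then i < j else j < i.

(** A move upwards is followed only by moves upwards or rest, and likewise downwards. So a moving
    orbit is strictly monotone, and the bound [B] stops it within [B] steps. *)
Lemma iter_stable (f : nat -> nat) (P : nat -> Prop) (B u : nat) :
  (forall x, P x -> P (f x)) -> (forall x, P x -> x <= B) ->
  (forall x, P x -> x < f x -> f x <= f (f x)) -> (forall x, P x -> f x < x -> f (f x) <= f x) ->
  P u -> f (iter B f u) = iter B f u.
Proof.
move=> Pf PB up dn Pu.
have Pk k : P (iter k f u) by elim: k => //= k; apply: Pf.
have key k : f (iter k f u) = iter k f u \/ (k < iter k.+1 f u /\ iter k f u < iter k.+1 f u) \/
    (k + iter k.+1 f u < B /\ iter k.+1 f u < iter k f u).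
  elim: k => [|k IH] /=.
    by have := PB _ Pu; case: (ltngtP u (f u)) => h; [right; left|right; right|left]; lia.
  have := Pk k; set x := iter k f u in IH *; move=> Px; rewrite /= -/x in IH.
  case: IH => [h|[[h1 h2]|[h1 h2]]]; first by left; rewrite !h.
    by have := up _ Px h2; case: (ltngtP (f x) (f (f x))) => h; [right; left|lia|left]; lia.
  by have := dn _ Px h2; case: (ltngtP (f x) (f (f x))) => h; [lia|right; right|left]; lia.
have := PB _ (Pk B.+1); case: (key B) => // -[[h1 _]|[h1 _]]; lia.
Qed.

Lemma ltdN e i j : ltd (~~ e) i j = ltd e j i.
Proof. by case: e. Qed.

Lemma ltd_trans e i j k : ltd e i j -> ltd e j k -> ltd e i k.
Proof. by clear; rewrite /ltd; case: e; lia. Qed.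

Lemma ltd_irr e i : ltd e i i = false.
Proof. by clear; rewrite /ltd; case: e; lia. Qed.

Lemma ltd_total e i j : i <> j -> ltd e i j \/ ltd e j i.
Proof. by clear; rewrite /ltd; case: e; lia. Qed.

(* A boolean s names one of the two arcs cut out by a and b; its points have the positions
   0, ..., m s, with a and b at the ends. val s E i is 1 + [i in E] - [i in K] at inner positions
   and 2 * [i in E] at the ends, with E and K complemented on the second arc. A boolean e is a
   direction of travel along an arc, from lo e to hi e. *)
Section Blocking.

Variables (T : finType) (m : bool -> nat) (val : bool -> T -> nat -> nat).

Definition lo (e : bool) s := if e then 0 else m s.
Definition hi (e : bool) s := if e then m s else 0.

Lemma loN e s : lo (~~ e) s = hi e s. Proof. by case: e. Qed.
Lemma hiN e s : hi (~~ e) s = lo e s. Proof. by case: e. Qed.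

Lemma le_lo e s : lo e s <= m s. Proof. by case: e => /=. Qed.
Lemma le_hi e s : hi e s <= m s. Proof. by case: e => /=. Qed.

(** The witnesses of a block must see each other, with no value 0 strictly between them. The use of
    [minn] and [maxn] makes this independent of the direction of travel. *)
Definition con s E (i j : nat) :=
  all (fun k => val s E k != 0) (iota (minn i j).+1 (maxn i j - (minn i j).+1)).

Lemma conP s E i j :
  reflect (forall k, minn i j < k < maxn i j -> 0 < val s E k) (con s E i j).
Proof.
apply: (iffP allP) => H k hk.
  by rewrite lt0n; apply: H; rewrite mem_iota; lia.
by rewrite -lt0n; apply: H; move: hk; rewrite mem_iota; lia.
Qed.

Definition haszero s E := has (fun i => val s E i == 0) (iota 0 (m s).+1).

Lemma haszeroP s E : reflect (exists2 i, i <= m s & val s E i = 0) (haszero s E).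
Proof.
apply: (iffP hasP) => [[i]|[i im /eqP v0]]; last by exists i => //; rewrite mem_iota; lia.
by rewrite mem_iota => h /eqP v0; exists i => //; lia.
Qed.

Section Blocked.
Variable L : bool -> seq nat.

(** This is the trace on the two arcs of a crossing between [E] and [K] with [z] added, except that
    the witnesses must be ends or members of [L]. Hence deleting candidates can free others. The
    last clause asks for an element of [K] missing from [E]: a value 0 on the arc of [z], or, after
    complementation, a candidate of value 2 on the opposite arc. *)
Definition blocked s z E :=
  [&& val s E z == 1,
      has (fun l => has (fun r => [&& l < z, z < r, val s E l == 2, val s E r == 2 & con s E l r])
                        (m s :: L s)) (0 :: L s)
    & haszero s E || has (fun y => val (~~ s) E y == 2) (L (~~ s))].

(** The same condition read in direction [e], with [l] on the near side and [r] on the far side of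
    [z], so that an argument and its mirror image are treated at once. *)
Definition Blocked (e : bool) s z E := [/\ val s E z = 1,
  exists l r, [/\ l \in lo e s :: L s, r \in hi e s :: L s, ltd e l z /\ ltd e z r,
     val s E l = 2 /\ val s E r = 2 & con s E l z /\ con s E z r] &
  haszero s E \/ exists2 y, y \in L (~~ s) & val (~~ s) E y = 2].

Lemma blockedP e s z E : reflect (Blocked e s z E) (blocked s z E).
Proof.
apply: (iffP and3P) => -[].
  move=> /eqP z1 /hasP[l ll] /hasP[r rr] /and5P[lz zr /eqP l2 /eqP r2 /conP lr] h.
  split=> //; last by case/orP: h => [->|/hasP[y yL /eqP y2]]; [left|right; exists y].
  have c1: con s E l z by apply/conP => k hk; apply: lr; lia.
  have c2: con s E z r by apply/conP => k hk; apply: lr; lia.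
  have cS i j : con s E i j -> con s E j i by rewrite /con minnC maxnC.
  by case: e; [exists l, r|exists r, l]; split=> //=; split=> //; apply: cS.
move=> z1 [l [r [ll rr [lz zr] [l2 r2] [/conP c1 /conP c2]]]] h; split; first exact/eqP.
  have c3 : con s E l r.
    apply/conP => k hk; have [->|kz] := eqVneq k z; first by rewrite z1.
    case: (e) lz zr => /= lz zr.
      by case: (ltnP k z) => hz; [apply: c1|apply: c2]; lia.
    by case: (ltnP k z) => hz; [apply: c2|apply: c1]; lia.
  have cS i j : con s E i j -> con s E j i by rewrite /con minnC maxnC.
  move: ll rr lz zr; rewrite /lo /hi /ltd; case: (e) => ll rr lz zr.
    apply/hasP; exists l => //; cbv beta; apply/hasP; exists r => //; apply/and5P; split=> //; exact/eqP.
  apply/hasP; exists r => //; cbv beta; apply/hasP; exists l => //; apply/and5P; split=> //; [exact/eqP|exact/eqP|exact: cS].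
case: h => [->//|[y yL y2]]; apply/orP; right; apply/hasP; exists y => //; exact/eqP.
Qed.

End Blocked.

Definition remc (L : bool -> seq nat) (s : bool) (w : nat) : bool -> seq nat :=
  fun t => if t == s then [seq i <- L t | i != w] else L t.

Lemma remcN L s w : remc L s w (~~ s) = L (~~ s).
Proof. by rewrite /remc; case: s. Qed.

Lemma con_sym s E i j : con s E i j = con s E j i.
Proof. by rewrite /con minnC maxnC. Qed.

Lemma con_sub e s E i j k l : con s E i j -> ltd e i k || (i == k) -> ltd e l j || (l == j) ->
  ltd e k l -> con s E k l.
Proof.
move=> /conP c h1 h2 kl; apply/conP => x hx; apply: c.
by move: h1 h2 kl hx; clear; rewrite /ltd; case: e; lia.
Qed.

Lemma con_cat e s E i j k : con s E i j -> con s E j k -> 0 < val s E j ->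
  ltd e i j -> ltd e j k -> con s E i k.
Proof.
move=> /conP c1 /conP c2 j0 ij jk; apply/conP => x hx.
have [->//|xj] := eqVneq x j.
have [h|h] : ltd e x j \/ ltd e j x by move: xj; clear; rewrite /ltd; case: e; lia.
  by apply: c1; move: ij jk h hx; clear; rewrite /ltd; case: e; lia.
by apply: c2; move: ij jk h hx; clear; rewrite /ltd; case: e; lia.
Qed.

End Blocking.

Arguments conP {T val s E i j}.
Arguments haszeroP {T m val s E}.
Arguments blockedP {T m val L} e {s z E}.

(** * Non-crossing families seen from the two arcs *)

Section Words.

Variables (T : finType) (Fam : pred T) (m : bool -> nat).
Variables (val : bool -> T -> nat -> nat) (lv : bool -> nat -> Prop).
Local Notation lo := (lo m).
Local Notation hi := (hi m).
Local Notation con := (con val).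
Local Notation haszero := (haszero m val).
Local Notation blocked := (blocked m val).
Variables eA eB : T.

Hypothesis end_val : forall s E, val (~~ s) E 0 = 2 - val s E (m s).
Hypothesis end_0m : forall s E, val s E 0 = 0 \/ val s E 0 = 2.
Hypothesis val_le2 : forall s E i, val s E i <= 2.
Hypothesis lvP : forall s i, lv s i -> 0 < i < m s /\ forall E, 0 < val s E i.
(** [nc4], [nc31] and [nc22] express that two members do not cross, sorted by how many of the four
    alternating points lie on each arc. Complementation reverses the inequalities on the opposite
    arc. *)
Hypothesis nc4 : forall s E F i j k l, Fam E -> Fam F -> i < j -> j < k -> k < l -> l <= m s ->
  val s F i < val s E i -> val s E j < val s F j ->
  val s F k < val s E k -> val s E l < val s F l -> False.
Hypothesis nc31 : forall s E F i j k y, Fam E -> Fam F -> i < j -> j < k -> k <= m s ->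
  0 < y < m (~~ s) ->
  val s F i < val s E i -> val s E j < val s F j -> val s F k < val s E k ->
  val (~~ s) F y < val (~~ s) E y -> False.
Hypothesis nc22 : forall s E F i j k l, Fam E -> Fam F ->
  0 < i -> i < j -> j < m s -> 0 < k -> k < l -> l < m (~~ s) ->
  val s F i < val s E i -> val s E j < val s F j ->
  val (~~ s) E k < val (~~ s) F k -> val (~~ s) F l < val (~~ s) E l -> False.
(** For [s = true]: a set missing both [a] and [b] cannot have elements outside [K] on both arcs,
    and a value 0 on the complemented arc is such an element. The case [s = false] is the dual. *)
Hypothesis ends0 : forall s E i j, Fam E -> val s E 0 = 0 -> val s E (m s) = 0 ->
  i <= m s -> val s E i = 2 -> j <= m (~~ s) -> 0 < val (~~ s) E j.
Hypothesis eAF : Fam eA.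
Hypothesis eBF : Fam eB.
Hypothesis eAv : forall s, val s eA 0 = 2 /\ val s eA (m s) = 0.
Hypothesis eBv : forall s, val s eB 0 = 0 /\ val s eB (m s) = 2.
Hypothesis eA1 : forall s i, 0 < i < m s -> val s eA i = 1.
Hypothesis eB1 : forall s i, 0 < i < m s -> val s eB i = 1.

Lemma end_valm s E : val (~~ s) E (m (~~ s)) = 2 - val s E 0.
Proof. by have := end_val (~~ s) E; rewrite negbK; have := val_le2 (~~ s) E (m (~~ s)); lia. Qed.

Lemma end_m s E : val s E (m s) = 0 \/ val s E (m s) = 2.
Proof. by have := end_val s E; have := end_0m (~~ s) E; have := val_le2 s E (m s); lia. Qed.

Lemma nc4e e s E F i j k l : Fam E -> Fam F -> ltd e i j -> ltd e j k -> ltd e k l ->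
  i <= m s -> l <= m s ->
  val s F i < val s E i -> val s E j < val s F j ->
  val s F k < val s E k -> val s E l < val s F l -> False.
Proof.
case: e => /= FE FF ij jk kl im lm h1 h2 h3 h4.
  exact: (nc4 FE FF ij jk kl lm).
exact: (nc4 FF FE kl jk ij im).
Qed.

Lemma nc31e e s E F i j k y : Fam E -> Fam F -> ltd e i j -> ltd e j k ->
  i <= m s -> k <= m s -> 0 < y < m (~~ s) ->
  val s F i < val s E i -> val s E j < val s F j -> val s F k < val s E k ->
  val (~~ s) E y <= val (~~ s) F y.
Proof.
move=> FE FF ij jk im km ym h1 h2 h3; rewrite leqNgt; apply/negP => h4.
case: e ij jk => /= ij jk; first exact: (nc31 FE FF ij jk km ym h1 h2 h3 h4).
exact: (nc31 FE FF jk ij im ym h3 h2 h1 h4).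
Qed.

(* L is a set of live candidates all of which are blocked; nx (s, w) is free once w is deleted. *)
Section Stuck.

Variables (L : bool -> seq nat) (nx : bool * nat -> bool * nat) (blk : bool * nat -> T).
Hypothesis Llv : forall s i, i \in L s -> lv s i.
Hypothesis nxL : forall s w, w \in L s -> (nx (s, w)).2 \in L (nx (s, w)).1.
Hypothesis nx_neq : forall s w, w \in L s -> nx (s, w) != (s, w).
Hypothesis nx_crit : forall s w E, w \in L s -> Fam E ->
  ~~ blocked (remc L s w) (nx (s, w)).1 (nx (s, w)).2 E.
Hypothesis blkF : forall s z, z \in L s -> Fam (blk (s, z)).
Hypothesis blkB : forall s z, z \in L s -> blocked L s z (blk (s, z)).

Lemma L_range s i : i \in L s -> 0 < i < m s.
Proof. by move/Llv/lvP=> []. Qed.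

Lemma L_pos s i E : i \in L s -> 0 < val s E i.
Proof. by move/Llv/lvP=> []. Qed.

(** Any other such [l] could serve as near witness, and the block would survive the deletion of [w]:
    the far witness lies beyond [z], so it is not [w]. *)
Lemma critR e s w z E : w \in L s -> nx (s, w) = (s, z) -> ltd e w z -> Fam E ->
  blocked L s z E -> forall l, l \in lo e s :: L s -> ltd e l z -> val s E l = 2 ->
  con s E l z -> l = w.
Proof.
move=> wL nxw wz FE Bz l ll lz l2 clz; have := nx_crit wL FE; rewrite nxw /=.
move=> /negP nB; apply/eqP/negPn/negP => lw; apply: nB; apply/(blockedP e).
have/(blockedP e)[z1 [l' [r [_ rr [_ zr] [_ r2] [_ cr]]]] h] := Bz.
split=> //.
  exists l, r; split=> //; rewrite /remc eqxx.
    by move: ll; rewrite !inE mem_filter lw.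
  move: rr; rewrite !inE mem_filter => /orP[->//|rL]; apply/orP; right.
  by rewrite rL andbT; apply/eqP => rw; move: wz zr; rewrite rw; clear; rewrite /ltd; case: e; lia.
case: h => [h|[y yL y2]]; [by left|right; exists y => //].
by rewrite /remc; case: (s) yL.
Qed.

(* The zero x0 hides everything beyond w. *)
Lemma stopper e s w z E : w \in L s -> nx (s, w) = (s, z) -> ltd e w z -> Fam E ->
  blocked L s z E -> exists x0, [/\ x0 <= m s, ltd e x0 w, val s E x0 = 0 & con s E x0 z].
Proof.
move=> wL nxw wz FE Bz.
have wr := L_range wL.
have [zL zr] : z \in L s /\ 0 < z < m s.
  by have := nxL wL; rewrite nxw /= => zL; split=> //; exact: L_range zL.
have uniq := critR wL nxw wz FE Bz.
have/(blockedP e)[z1 [l [r [ll rr [lz zr'] [l2 r2] [cl cr]]]] h] := Bz.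
have lw : l = w by apply: uniq.
rewrite {l}lw in ll l2 lz cl.
(* The near end is not a candidate, so it cannot be the witness [w]. Hence it has value 0, or a zero
   lies between it and [z]; the zero nearest to [z] is chosen. *)
have ex : exists d, has (fun x => [&& ltd e x z, val s E x == 0 & (z - x + (x - z)) == d]) (iota 0 (m s).+1).
  have : ~~ con s E (lo e s) z || (val s E (lo e s) == 0).
    apply/negPn/negP; rewrite negb_or negbK => /andP[c0 v0].
    have v2 : val s E (lo e s) = 2.
      by case: (e) v0; rewrite /lo => v0; [case: (end_0m s E)|case: (end_m s E)] => // h0; rewrite h0 in v0.
    have loz : ltd e (lo e s) z by move: zr; clear; rewrite /ltd /lo; case: e; lia.
    have := uniq (lo e s) (mem_head _ _) loz v2 c0.
    by move: wr; clear; rewrite /lo; case: e; lia.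
  case/orP => [/allPn[k hk /negPn/eqP k0]|/eqP v0].
    exists (z - k + (k - z)); apply/hasP; exists k; rewrite ?k0 ?eqxx ?andbT.
      by move: hk zr; clear; rewrite /lo; case: e; rewrite !mem_iota; lia.
    by move: hk zr; clear; rewrite /lo /ltd; case: e; rewrite !mem_iota; lia.
  exists (z - lo e s + (lo e s - z)); apply/hasP; exists (lo e s); rewrite ?v0 ?eqxx ?andbT.
    by clear; rewrite /lo; case: e; rewrite !mem_iota; lia.
  by move: zr; clear; rewrite /ltd /lo; case: e; lia.
case: (ex_minnP ex) => d /hasP[x xr /and3P[xz /eqP x0 /eqP dx]] dmin.
have xm : x <= m s by move: xr; clear; rewrite mem_iota; lia.
exists x; split=> //.
  have xw : x <> w by move=> xw; rewrite xw l2 in x0.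
  have nb : ~ (minn w z < x < maxn w z) by move/(conP cl); rewrite x0.
  by move: xz wz nb xw; clear; rewrite /ltd; case: e; lia.
apply/conP => k hk; rewrite lt0n; apply/negP => /eqP k0.
have : d <= z - k + (k - z).
  apply: dmin; apply/hasP; exists k; rewrite ?k0 ?eqxx ?andbT.
    by move: xm hk zr; clear; rewrite mem_iota; lia.
  by move: xz hk; clear; rewrite /ltd; case: e; lia.
by move: xz hk dx; clear; rewrite /ltd; case: e; lia.
Qed.

(** The profile of a blocking set along a move inside an arc. Candidates between [x0] and [z] other
    than [w] have value 1, since a value 2 would give a second near witness. *)
Lemma edgeP e s w z E : w \in L s -> nx (s, w) = (s, z) -> ltd e w z -> Fam E ->
  blocked L s z E ->
  [/\ val s E z = 1, val s E w = 2, con s E w z,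
      exists r, [/\ r \in hi e s :: L s, ltd e z r, val s E r = 2 & con s E z r] &
      exists x0, [/\ x0 <= m s, ltd e x0 w, val s E x0 = 0, con s E x0 z &
        forall u, u \in L s -> ltd e x0 u -> ltd e u z -> u <> w -> val s E u = 1]].
Proof.
move=> wL nxw wz FE Bz.
have uniq := critR wL nxw wz FE Bz.
have [x0 [x0m x0w vx0 cx0]] := stopper wL nxw wz FE Bz.
have/(blockedP e)[z1 [l [r [ll rr [lz zr] [l2 r2] [cl cr]]]] h] := Bz.
have lw : l = w by apply: uniq.
rewrite lw in l2 cl.
split=> //; first by exists r.
exists x0; split=> // u uL x0u uz uw.
have := L_pos E uL; have := val_le2 s E u.
case: (val s E u =P 2) => [u2|]; last by clear; lia.
case: uw; apply: (uniq u) => //; first by rewrite inE uL orbT.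
by apply: (@con_sub _ _ e _ _ x0 z) => //; rewrite ?x0u ?eqxx ?orbT.
Qed.

Lemma lo_le e s x : x <= m s -> ltd e x (lo e s) = false.
Proof. by clear; rewrite /ltd /lo; case: e; lia. Qed.

Lemma hi_le e s x : x <= m s -> ltd e (hi e s) x = false.
Proof. by clear; rewrite /ltd /hi; case: e; lia. Qed.

Lemma L_le s u : u \in L s -> u <= m s.
Proof. by move/L_range; lia. Qed.

Lemma lo_lt e s u : u \in L s -> ltd e (lo e s) u.
Proof. by move/L_range; clear; rewrite /ltd /lo; case: e; lia. Qed.

Lemma hi_gt e s u : u \in L s -> ltd e u (hi e s).
Proof. by move/L_range; clear; rewrite /ltd /hi; case: e; lia. Qed.

Lemma nxin s w s' z : w \in L s -> nx (s, w) = (s', z) -> z \in L s'.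
Proof. by move=> wL nxw; have := nxL wL; rewrite nxw. Qed.

(** If the second move turned back, it would reach [w] or beyond, and the sets blocking [z] and [z2]
    would alternate at four points [p1], [w], [z], [p4] of the arc. *)
Lemma dir_const e s w z z2 : w \in L s -> nx (s, w) = (s, z) -> nx (s, z) = (s, z2) ->
  ltd e w z -> ltd e z z2.
Proof.
move=> wL nxw nxz wz.
have zL := nxin wL nxw; have z2L := nxin zL nxz.
have zz2 : z <> z2 by move=> h; have := nx_neq zL; rewrite nxz h eqxx.
case: (ltd_total e zz2) => // z2z; exfalso.
have FE := blkF zL; have BE := blkB zL; set E := blk (s, z) in FE BE.
have FE2 := blkF z2L; have BE2 := blkB z2L; set E2 := blk (s, z2) in FE2 BE2.
have zz2' : ltd (~~ e) z z2 by rewrite ltdN.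
have [Ez Ew cwz [r [rr zr Er czr]] [x0 [x0m x0w Ex0 cx0 hid]]] := edgeP wL nxw wz FE BE.
have [E2z2 E2z czz2 [l2 [ll2 z2l2 El2 cz2l2]] [p [pm zp E2p cp hid2]]] :=
  edgeP zL nxz zz2' FE2 BE2.
rewrite ltdN in zp; rewrite hiN in ll2; rewrite ltdN in z2l2.
(* Otherwise [E] blocks [z2] as well, with witnesses [w] and [r], and uniqueness of the witness for
   the backward move would force [r = z]. *)
have z2w : ltd e z2 w || (z2 == w).
  apply/negPn/negP; rewrite negb_or => /andP[nz2w /eqP z2w].
  have wz2 : ltd e w z2 by case: (ltd_total e z2w) => // h; rewrite h in nz2w.
  have Ez2 : val s E z2 = 1.
    by apply: hid => //; exact: ltd_trans wz2.
  have z2r : ltd e z2 r := ltd_trans z2z zr.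
  have cwr : con s E w r by apply: (con_cat cwz czr) wz zr; rewrite Ez.
  have cwz2 : con s E w z2 by apply: (@con_sub _ _ e _ _ w r _ _ cwr); rewrite ?eqxx ?z2r ?orbT.
  have cz2r : con s E z2 r by apply: (@con_sub _ _ e _ _ w r _ _ cwr); rewrite ?eqxx ?wz2 ?orbT.
  have Bz2 : blocked L s z2 E.
    apply/(blockedP e); split=> //; last by left; apply/haszeroP; exists x0.
    by exists w, r; rewrite inE wL orbT.
  have := critR zL nxz zz2' FE Bz2 (l := r).
  rewrite loN ltdN con_sym => /(_ rr z2r Er cz2r) rz.
  by rewrite rz ltd_irr in zr.
have l2w : ltd e l2 w by case/orP: z2w => [h|/eqP <- //]; exact: ltd_trans h.
(* The point is the far witness [l2] of [E2] if that lies after the zero [x0] of [E], and [x0]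
   itself otherwise. The point [p4] is found in the same way from [r] and [p]. *)
have [p1 [p1m p1w v1]] : exists p1, [/\ p1 <= m s, ltd e p1 w & val s E p1 < val s E2 p1].
  have [x0l2|x0l2] := boolP (ltd e x0 l2).
    have l2L : l2 \in L s.
      by move: ll2; rewrite inE => /orP[/eqP h|//]; rewrite h lo_le in x0l2.
    exists l2; split=> //; first exact: L_le.
    by rewrite El2 hid //; [exact: ltd_trans wz|move=> h; rewrite h ltd_irr in l2w].
  exists x0; split=> //; rewrite Ex0; have [->|/eqP x0l2'] := eqVneq x0 l2; first by rewrite El2.
  have l2x0 : ltd e l2 x0 by case: (ltd_total e x0l2') => // h; rewrite h in x0l2.
  have x0z2 : x0 <> z2 by move=> h; have := L_pos E z2L; rewrite -h Ex0.
  case: (ltd_total e x0z2) => h.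
    by move/conP: cz2l2; apply; move: l2x0 h; clear; rewrite /ltd; case: e; lia.
  have x0z := ltd_trans x0w wz.
  have [/eqP->|x0p] := boolP (x0 == z); first by rewrite E2z.
  by move/conP: cp; apply; move: x0z zp h; clear; rewrite /ltd; case: e; lia.
have v2 : val s E2 w < val s E w.
  rewrite Ew; have [<-|z2w'] := eqVneq z2 w; first by rewrite E2z2.
  rewrite (hid2 w) //; rewrite ?ltdN; first exact: ltd_trans zp.
    by move: z2w; rewrite (negbTE z2w') orbF.
  by move=> h; rewrite h ltd_irr in wz.
have v3 : val s E z < val s E2 z by rewrite Ez E2z.
have [p4 [p4m zp4 v4]] : exists p4, [/\ p4 <= m s, ltd e z p4 & val s E2 p4 < val s E p4].
  have [rp|rp] := boolP (ltd e r p).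
    have rL : r \in L s by move: rr; rewrite inE => /orP[/eqP h|//]; rewrite h hi_le in rp.
    exists r; split=> //; first exact: L_le.
    rewrite Er (hid2 r) // ?ltdN //; first exact: ltd_trans zr.
    by move=> h; rewrite h ltd_irr in zr.
  exists p; split=> //; rewrite E2p; have [->|/eqP pr] := eqVneq p r; first by rewrite Er.
  have pr' : ltd e p r by case: (ltd_total e pr) => // h; rewrite h in rp.
  by move/conP: czr; apply; move: zp pr'; clear; rewrite /ltd; case: e; lia.
exact: (nc4e FE2 FE p1w wz zp4 p1m p4m v1 v2 v3 v4).
Qed.

(** The two blocking sets already alternate at [z] and at one point on each side of it, so a drop on
    the opposite arc would complete a crossing. *)
Lemma mono e s w z z2 E E2 y : w \in L s -> nx (s, w) = (s, z) -> nx (s, z) = (s, z2) ->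
  ltd e w z -> Fam E -> blocked L s z E -> Fam E2 -> blocked L s z2 E2 ->
  0 < y < m (~~ s) -> val (~~ s) E y <= val (~~ s) E2 y.
Proof.
move=> wL nxw nxz wz FE BE FE2 BE2 ym.
have zL := nxin wL nxw; have z2L := nxin zL nxz.
have zz2 := dir_const wL nxw nxz wz.
have [Ez Ew cwz [r [rr zr Er czr]] [x0 [x0m x0w Ex0 cx0 hid]]] := edgeP wL nxw wz FE BE.
have [E2z2 E2z czz2 _ [p [pm pz E2p cp hid2]]] := edgeP zL nxz zz2 FE2 BE2.
have cwr : con s E w r by apply: (con_cat cwz czr) wz zr; rewrite Ez.
have [i [im iz vi]] : exists i, [/\ i <= m s, ltd e i z & val s E2 i < val s E i].
  have [pw|pw] := boolP (ltd e p w).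
    exists w; split=> //; first exact: L_le.
    rewrite Ew hid2 //; first exact: ltd_trans zz2.
    by move=> h; rewrite h ltd_irr in wz.
  exists p; split=> //; rewrite E2p.
  have pw' : p <> w by move=> h; have := L_pos E2 wL; rewrite -h E2p.
  have wp : ltd e w p by case: (ltd_total e pw') => // h; rewrite h in pw.
  by move/conP: cwz; apply; move: wp pz; clear; rewrite /ltd; case: e; lia.
have vj : val s E z < val s E2 z by rewrite Ez E2z.
have [k [km zk vk]] : exists k, [/\ k <= m s, ltd e z k & val s E2 k < val s E k].
  have [rz2|rz2] := boolP (ltd e r z2).
    have rL : r \in L s.
      by move: rr; rewrite inE => /orP[/eqP h|//]; rewrite h (hi_le _ (L_le z2L)) in rz2.
    exists r; split=> //; first exact: L_le.
    rewrite Er hid2 //; first exact: ltd_trans zr.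
    by move=> h; rewrite h ltd_irr in zr.
  exists z2; split=> //; first exact: L_le.
  rewrite E2z2; have [<-|/eqP z2r] := eqVneq r z2; first by rewrite Er.
  have z2r' : ltd e z2 r by case: (ltd_total e z2r) => // h; rewrite h in rz2.
  have := L_pos E z2L; have := val_le2 s E z2.
  case: (val s E z2 =P 1) => [v1 _ _|]; last by clear; lia.
  have wz2 := ltd_trans wz zz2.
  have cwz2 : con s E w z2 by apply: (@con_sub _ _ e _ _ w r _ _ cwr); rewrite ?eqxx ?z2r' ?orbT.
  have Bz2 : blocked L s z2 E.
    apply/(blockedP e); split=> //; last by left; apply/haszeroP; exists x0.
    exists w, r; rewrite inE wL orbT; split=> //; split=> //.
    by apply: (@con_sub _ _ e _ _ w r _ _ cwr); rewrite ?eqxx ?wz2 ?orbT.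
  have := critR zL nxz zz2 FE Bz2 (l := w); rewrite inE wL orbT => /(_ isT wz2 Ew cwz2) h.
  by rewrite h ltd_irr in wz.
exact: (nc31e FE FE2 iz zk im km ym vi vj vk).
Qed.

(** Both witnesses lie on the arc of [z], so deleting [w] from the opposite arc can only destroy the
    last clause of the block. Therefore there is no zero near [z], and [w] is the only opposite
    candidate of value 2. *)
Lemma crossP s w z E : w \in L s -> nx (s, w) = (~~ s, z) -> Fam E -> blocked L (~~ s) z E ->
  [/\ val (~~ s) E z = 1, ~~ haszero (~~ s) E, val s E w = 2 &
      forall u, u \in L s -> u <> w -> val s E u = 1].
Proof.
move=> wL nxw FE Bz; have := nx_crit wL FE; rewrite nxw /= => nB.
have/(blockedP true)[z1 [l [r [ll rr lzr lr2 clr]]] h] := Bz.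
have nz : ~~ haszero (~~ s) E.
  apply/negP => hz; case/negP: nB; apply/(blockedP true); split=> //; last by left.
  by exists l, r; rewrite remcN.
have uniq u : u \in L s -> val s E u = 2 -> u = w.
  move=> uL u2; apply/eqP/negPn/negP => uw; case/negP: nB; apply/(blockedP true); split=> //.
    by exists l, r; rewrite remcN.
  by right; exists u; rewrite /remc negbK ?eqxx ?mem_filter ?uw.
have w2 : val s E w = 2.
  case: h => [h|[y]]; first by rewrite h in nz.
  by rewrite negbK => yL y2; rewrite -(uniq y).
split=> // u uL uw.
have := L_pos E uL; have := val_le2 s E u.
by case: (val s E u =P 2) => [/(uniq _ uL)//|]; clear; lia.
Qed.

Lemma crossP' s w z E : w \in L (~~ s) -> nx (~~ s, w) = (s, z) -> Fam E -> blocked L s z E ->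
  [/\ val s E z = 1, ~~ haszero s E, val (~~ s) E w = 2 &
      forall u, u \in L (~~ s) -> u <> w -> val (~~ s) E u = 1].
Proof. by have := @crossP (~~ s) w z E; rewrite negbK. Qed.

Lemma nozero s E i : ~~ haszero s E -> i <= m s -> 0 < val s E i.
Proof. by move=> /haszeroP nz im; rewrite lt0n; apply/eqP => h; apply: nz; exists i. Qed.

Lemma nozero_end e s E : ~~ haszero s E -> val s E (lo e s) = 2 /\ val (~~ s) E (lo e (~~ s)) = 0.
Proof.
move=> nz.
have h0 : val s E 0 = 2 by case: (end_0m s E) => // h; have := nozero nz (leq0n _); rewrite h.
have hm : val s E (m s) = 2 by case: (end_m s E) => // h; have := nozero nz (leqnn _); rewrite h.
by case: e => /=; rewrite ?end_val ?end_valm ?h0 ?hm.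
Qed.

(** Order properties are claimed only for candidates that are targets of moves, because criticality
    speaks about those alone. *)
Definition img s u := exists s' w, w \in L s' /\ nx (s', w) = (s, u).

Lemma imgL s u : img s u -> u \in L s.
Proof. by move=> [s' [w [wL /(nxin wL)]]]. Qed.

(** Without zeros the whole arc is visible, so the two ends and [w] already block [u]. A move to [u]
    inside the arc is impossible: its source would have to be the near end, which is not a
    candidate. *)
Lemma img_cross s u E (w : nat) : img s u -> Fam E -> ~~ haszero s E -> val s E u = 1 ->
  w \in L (~~ s) -> val (~~ s) E w = 2 ->
  exists w', [/\ w' \in L (~~ s), nx (~~ s, w') = (s, u), val (~~ s) E w' = 2 & blocked L s u E].
Proof.
move=> iu FE nz u1 wL w2; have uL := imgL iu.
have cc i j : i <= m s -> j <= m s -> con s E i j.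
  by move=> im jm; apply/conP => k hk; apply: nozero => //; lia.
have um := L_le uL.
have B : blocked L s u E.
  apply/(blockedP true); split=> //; last by right; exists w.
  exists (lo true s), (hi true s); rewrite !mem_head lo_lt // hi_gt //.
  have [h1 _] := nozero_end true nz; have [h2 _] := nozero_end false nz.
  by split=> //; split=> //; apply: cc => //; rewrite ?le_lo ?le_hi.
case: iu => s' [w' [w'L nxw']]; case: (s' =P s) => [ss|ss].
  rewrite ss in w'L nxw'.
  have wu : w' <> u by move=> h; have := nx_neq w'L; rewrite nxw' h eqxx.
  have [e we] : exists e, ltd e w' u.
    by case: (ltd_total true wu) => h; [exists true|exists false].
  have [h _] := nozero_end e nz.
  have := critR w'L nxw' we FE B (mem_head _ _) (lo_lt _ uL) h (cc _ _ (le_lo m _ _) um) => h'.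
  by have := L_range w'L; rewrite -h'; clear; rewrite /lo; case: e; lia.
have ss' : s' = ~~ s by move/eqP: ss; case: (s'); case: (s).
rewrite ss' in w'L nxw'; exists w'; split=> //.
by have [] := crossP' w'L nxw' FE B.
Qed.

(** With value 1, [u] would be blocked by [E] too and be reached from the only opposite candidate of
    value 2. That is [w], whose target is [z]. *)
Lemma cross_img s w z E u : w \in L (~~ s) -> nx (~~ s, w) = (s, z) -> Fam E -> blocked L s z E ->
  img s u -> u <> z -> val s E u = 2.
Proof.
move=> wL nxw FE B iu uz.
have [z1 nz w2 others] := crossP' wL nxw FE B.
have uL := imgL iu; have := L_pos E uL; have := val_le2 s E u.
case: (val s E u =P 1) => [u1 _ _|]; last by clear; lia.
have [w' [w'L nxw' w'2 _]] := img_cross iu FE nz u1 wL w2.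
case: (w' =P w) => [h|/(others _ w'L)]; last by rewrite w'2.
by case: uz; move: nxw'; rewrite h nxw => -[].
Qed.

(** Extends [mono] to the last move of a run, which leaves the arc; [mono_entry] does the same for
    the move by which the run enters. *)
Lemma mono_exit e s w z y E E2 x : w \in L s -> nx (s, w) = (s, z) -> ltd e w z ->
  nx (s, z) = (~~ s, y) -> Fam E -> blocked L s z E -> Fam E2 -> blocked L (~~ s) y E2 ->
  0 < x < m (~~ s) -> val (~~ s) E x <= val (~~ s) E2 x.
Proof.
move=> wL nxw wz nxz FE BE FE2 BE2 xm.
have zL := nxin wL nxw.
have [Ez Ew cwz [r [rr zr Er czr]] _] := edgeP wL nxw wz FE BE.
have [E2y nz E2z others] := crossP zL nxz FE2 BE2.
have rm : r <= m s by move: rr; rewrite inE => /orP[/eqP->|/L_le//]; rewrite le_hi.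
apply: (nc31e FE FE2 wz zr (L_le wL) rm xm).
- by rewrite Ew others // => h; rewrite h ltd_irr in wz.
- by rewrite Ez E2z.
rewrite Er; move: rr; rewrite inE => /orP[/eqP->|rL]; last first.
  by rewrite others // => h; rewrite h ltd_irr in zr.
by have [_] := nozero_end (~~ e) nz; rewrite negbK loN => ->.
Qed.

Lemma mono_entry e s v t t1 G E x : v \in L (~~ s) -> nx (~~ s, v) = (s, t) ->
  nx (s, t) = (s, t1) -> ltd e t t1 -> Fam G -> blocked L s t G -> Fam E -> blocked L s t1 E ->
  0 < x < m (~~ s) -> val (~~ s) G x <= val (~~ s) E x.
Proof.
move=> vL nxv nxt tt1 FG BG FE BE xm.
have tL := nxin vL nxv; have t1L := nxin tL nxt.
have [Et1 Et _ _ [p [pm pt Ep cp hid]]] := edgeP tL nxt tt1 FE BE.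
have [Gt nz Gv _] := crossP' vL nxv FG BG.
apply: (nc31e FG FE pt tt1 pm (L_le t1L) xm).
- by rewrite Ep; exact: nozero.
- by rewrite Gt Et.
rewrite Et1 (cross_img vL nxv FG BG) //; first by exists s, t.
by move=> h; rewrite h ltd_irr in tt1.
Qed.

(** * Runs on one arc and their exits *)

Definition step s u := if (nx (s, u)).1 == s then (nx (s, u)).2 else u.
(** Runs are monotone and bounded by [m s], so [m s] iterations bring them to rest, as [exit_fix]
    shows. *)
Definition exit s u := iter (m s) (step s) u.

Lemma stepP s u : u \in L s ->
  (nx (s, u) = (s, step s u) /\ step s u <> u) \/
  (exists y, nx (s, u) = (~~ s, y) /\ step s u = u).
Proof.
move=> uL; rewrite /step; case E: (nx (s, u)) => [s' z] /=; case: (s' =P s) => [ss|ss].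
  by left; rewrite ss; split=> // h; have := nx_neq uL; rewrite E ss h eqxx.
by right; exists z; split=> //; congr pair; move: ss; case: (s'); case: (s).
Qed.

Lemma step_in s u : u \in L s -> step s u \in L s.
Proof. by move=> uL; case: (stepP uL) => [[/(nxin uL)]|[y [_ ->]]]. Qed.

Lemma iter_step_in s u k : u \in L s -> iter k (step s) u \in L s.
Proof. by move=> uL; elim: k => //= k; apply: step_in. Qed.

Lemma step_dir e s u : u \in L s -> ltd e u (step s u) ->
  step s (step s u) = step s u \/ ltd e (step s u) (step s (step s u)).
Proof.
move=> uL us; case: (stepP uL) => [[nu _]|[y [_ h]]]; last by rewrite h ltd_irr in us.
case: (stepP (step_in uL)) => [[nu' _]|[y [_ h]]]; last by left.
by right; exact: dir_const nu nu' us.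
Qed.

Lemma exit_fix s u : u \in L s -> step s (exit s u) = exit s u.
Proof.
move=> uL; apply: (@iter_stable _ (fun x => x \in L s)) => //.
- by move=> x; apply: step_in.
- by move=> x; apply: L_le.
- move=> x xL h; case: (@step_dir true s x xL h) => [->//|]; exact: ltnW.
move=> x xL h; case: (@step_dir false s x xL h) => [->//|]; exact: ltnW.
Qed.

Lemma exit_in s u : u \in L s -> exit s u \in L s.
Proof. exact: iter_step_in. Qed.

Lemma exitP s u : u \in L s -> exists y, nx (s, exit s u) = (~~ s, y).
Proof.
move=> uL; case: (stepP (exit_in uL)) => [[_]|[y [h _]]]; last by exists y.
by rewrite exit_fix.
Qed.

Lemma exit_step s u : u \in L s -> exit s (step s u) = exit s u.
Proof. by move=> uL; rewrite /exit -iterSr /= -/(exit s u) exit_fix. Qed.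

Lemma exit_id s u y : u \in L s -> nx (s, u) = (~~ s, y) -> exit s u = u.
Proof.
move=> uL nu; have h : step s u = u by rewrite /step nu; case: (s).
by rewrite /exit; elim: (m s) => //= k ->.
Qed.

(** Along the run the value at [y] can only grow, and it ends at 1 with the set that blocks [y]
    itself. It is never 0, because [y] is live. *)
Lemma exit_val e s w z y E : w \in L s -> nx (s, w) = (s, z) -> ltd e w z ->
  nx (s, exit s w) = (~~ s, y) -> Fam E -> blocked L s z E -> val (~~ s) E y = 1.
Proof.
move=> wL nxw wz; have zL := nxin wL nxw.
have -> : exit s w = exit s z.
  by rewrite -(exit_step wL) /step nxw eqxx.
move=> nxy FE BE.
suff : val (~~ s) E y <= 1.
  by have := L_pos E (nxin (exit_in zL) nxy); lia.
have key k : forall w z E, w \in L s -> nx (s, w) = (s, z) -> ltd e w z -> Fam E ->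
    blocked L s z E -> nx (s, iter k (step s) z) = (~~ s, y) -> val (~~ s) E y <= 1.
  elim: k => [|k IH] {}w {}z {wL nxw wz zL nxy FE BE} E wL nxw wz FE BE nxy;
    have zL := nxin wL nxw.
    have yL := nxin zL nxy.
    have [h _ _ _] := crossP zL nxy (blkF yL) (blkB yL).
    rewrite -h; apply: (mono_exit wL nxw wz nxy FE BE (blkF yL) (blkB yL)).
    exact: L_range.
  case: (stepP zL) => [[nxz _]|[y' [nxy' hs]]]; last first.
    apply: (IH w z) => //.
    by move: nxy; rewrite iterSr hs.
  have z2L := nxin zL nxz.
  apply: leq_trans (IH _ _ _ zL nxz (dir_const wL nxw nxz wz) (blkF z2L) (blkB z2L) _).
    apply: (mono wL nxw nxz wz FE BE (blkF z2L) (blkB z2L)).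
    apply: (@L_range (~~ s)); apply: (nxin _ nxy); exact: iter_step_in.
  by rewrite -iterSr.
exact: (key _ _ _ _ wL nxw wz FE BE nxy).
Qed.

(** [eA] and [eB] stand for [K] with [a] or [b] added. They serve as comparison sets whose only
    values different from 1 are at the ends. *)
Lemma ref_set e s : exists R, [/\ Fam R, val s R (lo e s) = 0, val s R (hi e s) = 2 &
  forall i, 0 < i < m s -> val s R i = 1].
Proof.
case: e; [exists eB|exists eA]; split=> //; rewrite /lo /hi;
  by [case: (eBv s)|case: (eAv s)|apply: eB1|apply: eA1].
Qed.

Lemma end_lo e s E : val s E (lo e s) = 0 \/ val s E (lo e s) = 2.
Proof. by case: e; [exact: end_0m|exact: end_m]. Qed.

Lemma ltd_mid e s x u v : x <= m s -> u <= m s -> v <= m s -> ltd e u x -> ltd e x v -> 0 < x < m s.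
Proof. by clear; rewrite /ltd; case: e; lia. Qed.

Lemma end_other e s E : val (~~ s) E (lo e (~~ s)) = 2 - val s E (hi e s).
Proof. by case: e; rewrite /lo /hi ?end_val ?end_valm. Qed.

(** Suppose the far end has value 0. If the near end has value 2, [E] crosses a reference set. If it
    has value 0, the opposite arc has no zero, so [E] blocks the exit target [y], and [w] itself
    would have to move to [y]. A zero beyond [w] gives a crossing with the other reference set. *)
Lemma edge_hi e s w z E : w \in L s -> nx (s, w) = (s, z) -> ltd e w z -> Fam E ->
  blocked L s z E ->
  val s E (hi e s) = 2 /\ (forall x, x <= m s -> ltd e w x -> 0 < val s E x).
Proof.
move=> wL nxw wz FE BE; have zL := nxin wL nxw.
have [Ez Ew cwz _ [x0 [x0m x0w Ex0 cx0 hid]]] := edgeP wL nxw wz FE BE.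
have [y nxy] := exitP wL.
have Ey := exit_val wL nxw wz nxy FE BE.
have yL := nxin (exit_in wL) nxy.
have wm := L_le wL.
have hi2 : val s E (hi e s) = 2.
  case: (end_lo (~~ e) s E); rewrite loN // => h0.
  case: (end_lo e s E) => l0; last first.
    exfalso; have [R [FR R0 R2 R1]] := ref_set e s.
    have x0lo : ltd e (lo e s) x0.
      have : lo e s <> x0 by move=> h; rewrite h Ex0 in l0.
      by move=> h; case: (ltd_total e h) => //; rewrite lo_le.
    apply: (nc4e FE FR x0lo x0w (hi_gt e wL) (le_lo m e s) (le_hi m e s)).
    - by rewrite l0 R0.
    - by rewrite Ex0 R1 //; apply: (ltd_mid x0m (le_lo m e s) wm x0lo x0w).
    - by rewrite Ew R1 // L_range.
    by rewrite h0 R2.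
  exfalso.
  have [z0 zm] : val s E 0 = 0 /\ val s E (m s) = 0 by case: (e) h0 l0; rewrite /lo /hi.
  have nz : ~~ haszero (~~ s) E.
    by apply/haszeroP => -[j jm] h; have := ends0 FE z0 zm wm Ew jm; rewrite h.
  have iy : img (~~ s) y by exists s, (exit s w); split=> //; exact: exit_in.
  have [||w' []] := @img_cross (~~ s) y E w iy FE nz Ey; rewrite ?negbK // => w'L nxw' w'2 BE'.
  have [_ _ _ others] := crossP w'L nxw' FE BE'.
  have := others w wL; rewrite Ew => h; suff /h : w <> w' by [].
  by move=> h'; move: nxw'; rewrite -h' nxw; case: (s).
split=> // x xm wx.
rewrite lt0n; apply/eqP => vx.
have [R [FR R0 R2 R1]] := ref_set (~~ e) s; rewrite loN in R0; rewrite hiN in R2.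
have xhi : ltd e x (hi e s).
  have h : x <> hi e s by move=> h; rewrite -h vx in hi2.
  by case: (ltd_total e h) => //; rewrite hi_le.
apply: (nc4e FR FE x0w wx xhi x0m (le_hi m e s)).
- rewrite Ex0; have [<-|/eqP h] := eqVneq (lo e s) x0; first by rewrite R2.
  rewrite R1 //; apply: (ltd_mid x0m (le_lo m e s) wm _ x0w).
  by case: (ltd_total e h) => //; rewrite lo_le.
- by rewrite Ew R1 // L_range.
- by rewrite vx R1 //; apply: (ltd_mid xm wm (le_hi m e s) wx xhi).
by rewrite R0 hi2.
Qed.

(** With value 1, [u] would be blocked by [E] between [w] and the far end. Its source is not on the
    opposite arc, because of the zero [x0]; not beyond [u], where it would be the far end; and if it
    is before [u], it is [w], so [u = z]. *)
Lemma edge_adj e s w z E u : w \in L s -> nx (s, w) = (s, z) -> ltd e w z -> Fam E ->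
  blocked L s z E -> img s u -> ltd e w u -> u <> z -> val s E u = 2 /\ ltd e z u.
Proof.
move=> wL nxw wz FE BE iu wu uz; have zL := nxin wL nxw; have uL := imgL iu.
have [Ez Ew cwz _ [x0 [x0m x0w Ex0 cx0 hid]]] := edgeP wL nxw wz FE BE.
have [hi2 nz] := edge_hi wL nxw wz FE BE.
have uhi := hi_gt e uL.
have u2 : val s E u = 2.
  have := L_pos E uL; have := val_le2 s E u.
  case: (val s E u =P 1) => [u1 _ _|]; last by clear; lia.
  have c1 : con s E w u.
    apply/conP => k hk; apply: nz; first by have := L_le uL; have := L_le wL; move: hk; clear; lia.
    by move: wu hk; clear; rewrite /ltd; case: e; lia.
  have c2 : con s E u (hi e s).
    apply/conP => k hk; apply: nz.
      by have := L_le uL; have := le_hi m e s; move: hk; clear; lia.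
    by move: wu uhi hk; clear; rewrite /ltd; case: e; lia.
  have B : blocked L s u E.
    apply/(blockedP e); split=> //; last by left; apply/haszeroP; exists x0.
    by exists w, (hi e s); rewrite inE wL orbT mem_head.
  have [s' [w' [w'L nxw']]] := iu; case: (s' =P s) => [ss|ss]; last first.
    have ss' : s' = ~~ s by move/eqP: ss; case: (s'); case: (s).
    rewrite ss' in w'L nxw'; have [_ /haszeroP nzs _ _] := crossP' w'L nxw' FE B.
    by case: nzs; exists x0.
  rewrite {}ss in w'L nxw'.
  have wu' : w' <> u by move=> h; have := nx_neq w'L; rewrite nxw' h eqxx.
  case: (ltd_total e wu') => h.
    have := critR w'L nxw' h FE B (l := w); rewrite inE wL orbT => /(_ isT wu Ew c1) ww.
    by move: nxw'; rewrite -ww nxw => -[zu]; rewrite zu in uz.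
  rewrite -ltdN in h.
  have := critR w'L nxw' h FE B (l := hi e s).
  rewrite loN mem_head ltdN con_sym => /(_ isT uhi hi2 c2) ww.
  by have := L_range w'L; rewrite -ww; clear; rewrite /hi; case: e; lia.
split=> //; case: (ltd_total e uz) => // uz'.
have := hid u uL (ltd_trans x0w wu) uz'; rewrite u2 => h.
by suff /h : u <> w by []; move=> h'; rewrite h' ltd_irr in wu.
Qed.

Lemma step_adj e s w u : w \in L s -> img s u -> ltd e w u -> ltd e u (step s w) -> False.
Proof.
move=> wL iu wu us; case: (stepP wL) => [[nxw _]|[y [_ h]]]; last first.
  by rewrite h in us; have := ltd_trans wu us; rewrite ltd_irr.
have zL := nxin wL nxw.
have uz : u <> step s w by move=> h; rewrite -h ltd_irr in us.
have [_ zu] := edge_adj wL nxw (ltd_trans wu us) (blkF zL) (blkB zL) iu wu uz.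
by have := ltd_trans us zu; rewrite ltd_irr.
Qed.

Lemma img_step s u : img s u -> img s (step s u).
Proof.
move=> iu; have uL := imgL iu; case: (stepP uL) => [[nxu _]|[y [_ ->]]] //.
by exists s, u.
Qed.

(** By [step_adj] no step jumps over a target, so an inversion can only exchange [u1] and [u2]; then
    the run through them would turn back. *)
Lemma step_mono s u1 u2 : img s u1 -> img s u2 -> u1 <= u2 -> step s u1 <= step s u2.
Proof.
move=> i1 i2; rewrite leq_eqVlt => /orP[/eqP->//|u12]; rewrite leqNgt; apply/negP => h.
have a1 : step s u1 <= u2.
  by rewrite leqNgt; apply/negP => h'; exact: (@step_adj true s u1 u2 (imgL i1) i2 u12 h').
have a2 : u1 <= step s u2.
  by rewrite leqNgt; apply/negP => h'; exact: (@step_adj false s u2 u1 (imgL i2) i1 u12 h').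
have e1 : step s u1 = u2.
  apply/eqP; rewrite eqn_leq a1 leqNgt; apply/negP => h'.
  exact: (@step_adj false s u2 (step s u1) (imgL i2) (img_step i1) h' h).
have e2 : step s u2 = u1.
  apply/eqP; rewrite eqn_leq a2 andbT leqNgt; apply/negP => h'.
  exact: (@step_adj true s u1 (step s u2) (imgL i1) (img_step i2) h' h).
have := @step_dir true s u1 (imgL i1); rewrite e1 e2 => /(_ u12) [h'|h'].
  by rewrite h' ltnn in u12.
by have := ltn_trans u12 h'; rewrite ltnn.
Qed.

Lemma img_iter s u k : img s u -> img s (iter k (step s) u).
Proof. by move=> iu; elim: k => //= k; apply: img_step. Qed.

Lemma exit_mono s u1 u2 : img s u1 -> img s u2 -> u1 <= u2 -> exit s u1 <= exit s u2.
Proof.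
move=> i1 i2 u12; rewrite /exit; elim: (m s) => //= k IH.
by apply: step_mono => //; apply: img_iter.
Qed.

(** The sets blocking [y1] and [y2] differ in opposite ways at [h1] and [h2], and again at [y1] and
    [y2]. If the order were kept, this would be a crossing with two points on each arc. *)
Lemma cross_anti s h1 h2 y1 y2 : h1 \in L s -> h2 \in L s -> nx (s, h1) = (~~ s, y1) ->
  nx (s, h2) = (~~ s, y2) -> h1 <= h2 -> y2 <= y1.
Proof.
move=> h1L h2L n1 n2; rewrite leq_eqVlt => /orP[/eqP h12|h12].
  by move: n1; rewrite h12 n2 => -[->].
rewrite leqNgt; apply/negP => y12.
have y1L := nxin h1L n1; have y2L := nxin h2L n2.
have [v1 nz1 w1 o1] := crossP h1L n1 (blkF y1L) (blkB y1L).
have [v2 nz2 w2 o2] := crossP h2L n2 (blkF y2L) (blkB y2L).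
have i1 : img (~~ s) y1 by exists s, h1.
have i2 : img (~~ s) y2 by exists s, h2.
have [h10 _] := andP (L_range h1L); have [_ h2m] := andP (L_range h2L).
have [y10 _] := andP (L_range y1L); have [_ y2m] := andP (L_range y2L).
have c1 := @cross_img (~~ s) h1 y1 _ y2; have c2 := @cross_img (~~ s) h2 y2 _ y1.
rewrite negbK in c1 c2.
apply: (nc22 (blkF y1L) (blkF y2L) h10 h12 h2m y10 y12 y2m).
- by rewrite w1 (o2 _ h1L) // => h; rewrite h ltnn in h12.
- by rewrite w2 (o1 _ h2L) // => h; rewrite h ltnn in h12.
- rewrite v1 (c2 _ h2L n2 (blkF y2L) (blkB y2L) i1) //.
  by move=> h; rewrite h ltnn in y12.
rewrite v2 (c1 _ h1L n1 (blkF y1L) (blkB y1L) i2) //.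
by move=> h; rewrite h ltnn in y12.
Qed.

(** On the opposite arc the blocking sets of the run grow from move to move, but they are pinned: at
    the source [v] of the entry they have 2 from the start, at the exit target [y] they still have 1
    at the end. The final contradiction plays two such runs against each other. *)
Lemma run s t v y : v \in L (~~ s) -> nx (~~ s, v) = (s, t) -> nx (s, exit s t) = (~~ s, y) ->
  exists (k : nat) (tau : nat -> nat) (B : nat -> T) (e : bool),
  [/\ tau 0 = t, tau k = exit s t, forall i, i <= k -> tau i \in L s,
    forall i, i < k -> [/\ Fam (B i), val s (B i) (tau i) = 2, val s (B i) (tau i.+1) = 1,
      ltd e (tau i) (tau i.+1) & val s (B i) (hi e s) = 2 /\ val s (B i) (lo e s) = 0] &
    (forall i, i < k -> val (~~ s) (B i) v = 2 /\ val (~~ s) (B i) y = 1) /\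
    (forall i j x, i <= j -> j < k -> 0 < x < m (~~ s) ->
       val (~~ s) (B i) x <= val (~~ s) (B j) x)].
Proof.
move=> vL nxv nxy; have tL := nxin vL nxv.
pose tau i := iter i (step s) t.
have tauL i : tau i \in L s by exact: iter_step_in.
have ex : exists k, tau k == exit s t by exists (m s).
case: (ex_minnP ex) => k /eqP tk kmin.
have exit_tau i : exit s (tau i) = exit s t.
  by elim: i => //= i IH; rewrite exit_step // IH.
have nxt i : i < k -> nx (s, tau i) = (s, tau i.+1).
  move=> ik; case: (stepP (tauL i)) => [[->]//|[y' [ny' h]]].
  have := kmin i; rewrite -{1}(exit_tau i) (exit_id (tauL i) ny') eqxx => /(_ isT).
  by rewrite leqNgt ik.
have [e dir] : exists e, forall i, i < k -> ltd e (tau i) (tau i.+1).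
  have [->|k0] := posnP k; first by exists true.
  have ne : tau 0 <> tau 1.
    by move=> h; have := nx_neq (tauL 0); rewrite (nxt 0 k0) -h eqxx.
  have [e h0] : exists e, ltd e (tau 0) (tau 1).
    by case: (ltd_total true ne) => h; [exists true|exists false].
  exists e; elim=> // i IH ik; apply: (dir_const (tauL i) (nxt i (ltnW ik)) (nxt _ ik)).
  exact: IH (ltnW ik).
pose B i := blk (s, tau i.+1).
have FB i : Fam (B i) by exact: blkF.
have BB i : blocked L s (tau i.+1) (B i) by exact: blkB.
have step_le i x : i.+1 < k -> 0 < x < m (~~ s) -> val (~~ s) (B i) x <= val (~~ s) (B i.+1) x.
  move=> ik xm.
  exact: (mono (tauL i) (nxt i (ltnW ik)) (nxt _ ik) (dir i (ltnW ik)) (FB i) (BB i) (FB _) (BB _) xm).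
have incr i j x : i <= j -> j < k -> 0 < x < m (~~ s) -> val (~~ s) (B i) x <= val (~~ s) (B j) x.
  elim: j => [|j IH]; first by rewrite leqn0 => /eqP->.
  rewrite leq_eqVlt => /orP[/eqP->//|ij] jk xm.
  exact: leq_trans (IH ij (ltnW jk) xm) (step_le _ _ jk xm).
have Bv i : i < k -> val (~~ s) (B i) v = 2.
  move=> ik; have k0 : 0 < k by exact: leq_ltn_trans ik.
  apply/eqP; rewrite eqn_leq val_le2 /=.
  apply: leq_trans (incr 0 i v _ ik (L_range vL)) => //.
  have [_ _ <- _] := crossP' vL nxv (blkF tL) (blkB tL).
  exact: (mono_entry vL nxv (nxt 0 k0) (dir 0 k0) (blkF tL) (blkB tL) (FB 0) (BB 0) (L_range vL)).
have By i : i < k -> val (~~ s) (B i) y = 1.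
  move=> ik; apply: (exit_val (tauL i) (nxt i ik) (dir i ik) _ (FB i) (BB i)).
  by rewrite exit_tau.
exists k, tau, B, e; split=> //; last by split=> // i ik; split; [exact: Bv|exact: By].
move=> i ik.
have [Bz Bw _ _ [x0 [x0m _ Bx0 _ _]]] := edgeP (tauL i) (nxt i ik) (dir i ik) (FB i) (BB i).
have [Bhi _] := edge_hi (tauL i) (nxt i ik) (dir i ik) (FB i) (BB i).
split=> //; first exact: dir.
(* If the near end had value 2 as well, the opposite arc would have value 0 at both ends and 2 at
   [v]. Then [ends0] forbids the zero [x0] on this arc. *)
split=> //; case: (end_lo e s (B i)) => // Blo.
have E1 : val (~~ s) (B i) (lo e (~~ s)) = 0 by rewrite end_other Bhi.
have E2 : val (~~ s) (B i) (lo (~~ e) (~~ s)) = 0 by rewrite end_other hiN Blo.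
have [z0 zm] : val (~~ s) (B i) 0 = 0 /\ val (~~ s) (B i) (m (~~ s)) = 0.
  by case: (e) E1 E2; rewrite /lo.
have := ends0 (FB i) z0 zm (L_le vL) (Bv i ik); rewrite negbK => /(_ _ x0m).
by rewrite Bx0.
Qed.

(** * A cycle made of two runs *)

Definition turn s h := exit s (nx (~~ s, exit (~~ s) (nx (s, h)).2)).2.

Lemma turnP s h y : h \in L s -> nx (s, h) = (~~ s, y) ->
  exists t, [/\ nx (~~ s, exit (~~ s) y) = (s, t), exit (~~ s) y \in L (~~ s), t \in L s &
    turn s h = exit s t].
Proof.
move=> hL nh; have yL := nxin hL nh; have eL := exit_in yL.
have [t] := exitP yL; rewrite negbK => nt; exists t; split=> //; first exact: nxin nt.
by rewrite /turn nh /= nt.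
Qed.

Lemma turn_mono s h1 h2 y1 y2 : h1 \in L s -> h2 \in L s -> nx (s, h1) = (~~ s, y1) ->
  nx (s, h2) = (~~ s, y2) -> h1 <= h2 -> turn s h1 <= turn s h2.
Proof.
move=> h1L h2L n1 n2 h12; have y21 := cross_anti h1L h2L n1 n2 h12.
have [t1 [nt1 e1L t1L ->]] := turnP h1L n1; have [t2 [nt2 e2L t2L ->]] := turnP h2L n2.
have i1 : img (~~ s) y1 by exists s, h1.
have i2 : img (~~ s) y2 by exists s, h2.
have e21 := exit_mono i2 i1 y21.
have := @cross_anti (~~ s) (exit (~~ s) y2) (exit (~~ s) y1) t2 t1.
rewrite negbK => /(_ e2L e1L nt2 nt1 e21) t12.
apply: exit_mono => //; first by exists (~~ s), (exit (~~ s) y1).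
by exists (~~ s), (exit (~~ s) y2).
Qed.

(** One turn reverses the order twice, hence is monotone, and its iterates come to rest. The fixed
    point closes a cycle of [nx] with one run on each arc. *)
Lemma turn_fix s u : u \in L s -> exists2 h, h \in L s & turn s h = h /\
  exists y, nx (s, h) = (~~ s, y).
Proof.
move=> uL.
pose P h := h \in L s /\ exists y, nx (s, h) = (~~ s, y).
have Pt h : P h -> P (turn s h).
  move=> [hL [y nh]]; have [t [_ _ tL ->]] := turnP hL nh.
  by split; [exact: exit_in|exact: exitP].
have Pu : P (exit s u) by split; [exact: exit_in|exact: exitP].
have tm x z : P x -> P z -> x <= z -> turn s x <= turn s z.
  by move=> [xL [y1 n1]] [zL [y2 n2]]; exact: turn_mono n1 n2.
have Pi : P (iter (m s) (turn s) (exit s u)) by elim: (m s) => //= k; apply: Pt.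
exists (iter (m s) (turn s) (exit s u)); first by case: Pi.
split; last by case: Pi.
apply: (@iter_stable _ P) => //.
- by move=> x [/L_le].
- by move=> x Px /ltnW; apply: tm => //; apply: Pt.
by move=> x Px /ltnW; apply: tm => //; apply: Pt.
Qed.

Lemma first2 (f : nat -> nat) k : f 0 <> 2 -> f k = 2 ->
  exists2 i, i < k & f i.+1 = 2 /\ forall j, j <= i -> f j <> 2.
Proof.
move=> f0 fk; have ex : exists i, f i == 2 by exists k; rewrite fk.
case: (ex_minnP ex) => [[|i] /eqP fi imin]; first by case: f0.
exists i; first by rewrite imin // fk.
by split=> // j ji fj; have := imin j; rewrite fj eqxx => /(_ isT); rewrite leqNgt ltnS ji.
Qed.

Lemma stuck_false s u : u \in L s -> False.
Proof.
move=> uL; have [h hL [th [y nh]]] := turn_fix uL.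
have yL := nxin hL nh; have [t [nt vL tL ht]] := turnP hL nh; rewrite th in ht.
set v := exit (~~ s) y in nt vL.
have nh' : nx (s, exit s t) = (~~ s, y) by rewrite -ht.
have [k [tau [B [e [tau0 tauk tauL BP [Bvy Binc]]]]]] := run vL nt nh'.
have := @run (~~ s) y h t; rewrite !negbK -/v => /(_ hL nh nt).
move=> [l [sig [F [d [sig0 sigl sigL FP [Fht Finc]]]]]].
rewrite -ht in tauk.
(* If one run is a single point, so is the other: its blocking sets take different values at the
   start and the end of the first run. In that case the sets blocking [t] and [y] cross at the two
   ends, [t] and [y]. *)
have [k0|k0] := posnP k.
  have th' : t = h by rewrite -tau0 -tauk k0.
  have [l0|l0] := posnP l; last by have [] := Fht 0 l0; rewrite th' => ->.
  have yv : y = v by rewrite -sig0 -sigl l0.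
  have FG := blkF tL; have BG := blkB tL; have FH := blkF yL; have BH := blkB yL.
  have [Gt nzG Gv oG] := crossP' vL nt FG BG.
  have [Hy nzH Hh oH] := crossP hL nh FH BH.
  have G0 : val s (blk (s, t)) (lo true s) = 2 by case: (nozero_end true nzG).
  have G1 : val s (blk (s, t)) (hi true s) = 2 by case: (nozero_end false nzG).
  have H0 : val s (blk (~~ s, y)) (lo true s) = 0.
    by have [_] := nozero_end true nzH; rewrite negbK.
  have H1 : val s (blk (~~ s, y)) (hi true s) = 0.
    by have [_] := nozero_end false nzH; rewrite negbK.
  have := nc31e FG FH (lo_lt true tL) (hi_gt true tL) (le_lo m true s) (le_hi m true s) (L_range yL).
  by rewrite G0 G1 H0 H1 Gt Hy {1}th' Hh yv Gv => /(_ isT isT isT).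
have [l0|l0] := posnP l.
  by have [] := Bvy 0 k0; rewrite -sigl l0 sig0 => -> .
have tm i : i <= k -> tau i <= m s by move=> ik; exact: L_le (tauL i ik).
(* If [F j] jumps to 2 along move [i] of the first run, then [B i] cannot jump to 2 along move [j]
   of the second. Otherwise they cross, with two points on each arc if the runs have the same
   direction, and else at the two ends and two inner points of one arc. *)
have key i j : i < k -> j < l -> val s (F j) (tau i) <> 2 -> val s (F j) (tau i.+1) = 2 ->
    val (~~ s) (B i) (sig j) <> 2 -> val (~~ s) (B i) (sig j.+1) <> 2.
  move=> ik jl; have [FB Bi Bi1 dt [Bhi Blo]] := BP i ik; have [FF Fj Fj1 ds [Fhi Flo]] := FP j jl.
  have lt1 n : n <= 2 -> n <> 2 -> n < 2 by clear; lia.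
  move=> /(lt1 _ (val_le2 _ _ _)) f0 f1 /(lt1 _ (val_le2 _ _ _)) b0 b1.
  have [t0 tM] := andP (L_range (tauL i (ltnW ik))).
  have [t0' tM'] := andP (L_range (tauL i.+1 ik)).
  have [s0 sM] := andP (L_range (sigL j (ltnW jl))).
  have [s0' sM'] := andP (L_range (sigL j.+1 jl)).
  have v1 : val s (F j) (tau i) < val s (B i) (tau i) by rewrite Bi.
  have v2 : val s (B i) (tau i.+1) < val s (F j) (tau i.+1) by rewrite Bi1 f1.
  have v3 : val (~~ s) (B i) (sig j) < val (~~ s) (F j) (sig j) by rewrite Fj.
  have v4 : val (~~ s) (F j) (sig j.+1) < val (~~ s) (B i) (sig j.+1) by rewrite Fj1 b1.
  have [de|de] := eqVneq d e.
    rewrite de in ds; case: (e) dt ds => /= dt ds.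
      exact: (nc22 FB FF t0 dt tM' s0 ds sM' v1 v2 v3 v4).
    exact: (nc22 FF FB t0' dt tM s0' ds sM v2 v1 v4 v3).
  have {de} dE : d = ~~ e by move: de; case: (d); case: (e).
  have F0 : val s (F j) (hi e s) = 0.
    by have := end_other d (~~ s) (F j); rewrite negbK Fhi dE loN => ->.
  have F2 : val s (F j) (lo e s) = 2.
    by have := end_other (~~ d) (~~ s) (F j); rewrite negbK hiN Flo dE negbK => ->.
  apply: (nc4e FF FB (lo_lt e (tauL i (ltnW ik))) dt (hi_gt e (tauL i.+1 ik))
    (le_lo m e s) (le_hi m e s) _ v1 v2); first by rewrite F2 Blo.
  by rewrite F0 Bhi.
have Ft j : j < l -> val s (F j) (tau 0) <> 2 by move=> jl; rewrite tau0; have [_ ->] := Fht j jl.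
have Fh j : j < l -> val s (F j) (tau k) = 2 by move=> jl; rewrite tauk; have [->] := Fht j jl.
(* As [j] grows, the first jump of [F j] does not move forward, and [B i] does not grow when [i]
   decreases. So the value at [sig j] stays below 2 up to [sig l = v], where it must be 2. *)
have ind j : j < l -> exists i, [/\ i < k, val s (F j) (tau i.+1) = 2,
    forall i', i' <= i -> val s (F j) (tau i') <> 2 & val (~~ s) (B i) (sig j) <> 2].
  elim: j => [|j IH] jl.
    have [i ik [f1 f0]] := @first2 (fun i => val s (F 0) (tau i)) k (Ft 0 jl) (Fh 0 jl).
    by exists i; split=> //; rewrite sig0; have [_ ->] := Bvy i ik.
  have [i [ik f1 f0 b0]] := IH (ltnW jl).
  have b1 := key i j ik (ltnW jl) (f0 i (leqnn i)) f1 b0.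
  have f2 : val s (F j.+1) (tau i.+1) = 2.
    have := Finc j j.+1 (tau i.+1) (leqnSn j) jl; rewrite f1.
    by move=> /(_ (L_range (tauL i.+1 ik))); have := val_le2 s (F j.+1) (tau i.+1); lia.
  have [i' ik' [f1' f0']] := @first2 (fun i => val s (F j.+1) (tau i)) k (Ft _ jl) (Fh _ jl).
  have i'i : i' <= i by rewrite leqNgt; apply/negP => /f0'.
  exists i'; split=> // b; apply: b1; apply/eqP; rewrite eqn_leq val_le2 -b.
  exact: Binc i'i ik (L_range (sigL j.+1 (ltnW jl))).
have l1 : l.-1 < l by rewrite prednK.
have [i [ik f1 f0 b0]] := ind l.-1 l1.
have := key i l.-1 ik l1 (f0 i (leqnn i)) f1 b0; rewrite prednK // sigl.
by have [->] := Bvy i ik.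
Qed.

End Stuck.

(** * Existence of a free candidate *)

Lemma size_remc (L : bool -> seq nat) s w : w \in L s ->
  size (remc L s w true) + size (remc L s w false) < size (L true) + size (L false).
Proof.
move=> wL.
have h : size [seq i <- L s | i != w] < size (L s).
  rewrite size_filter -[ltnRHS](count_predC (fun i => i != w)) -[ltnLHS]addn0 ltn_add2l.
  by rewrite -has_count; apply/hasP; exists w => //=; rewrite eqxx.
by case: s wL h => wL h; rewrite /remc /=; [rewrite ltn_add2r|rewrite ltn_add2l].
Qed.

Definition free (L : bool -> seq nat) s z := [forall E, Fam E ==> ~~ blocked L s z E].

Lemma free_exists (L : bool -> seq nat) : (forall s i, i \in L s -> lv s i) ->
  (exists s i, i \in L s) -> exists s z, z \in L s /\ free L s z.
Proof.
have [N] := ubnP (size (L true) + size (L false)).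
elim: N L => // N IH L sN Llv [s0 [u0 u0L]].
pose cands := [seq (true, i) | i <- L true] ++ [seq (false, i) | i <- L false].
have mem_cands s i : ((s, i) \in cands) = (i \in L s).
  rewrite mem_cat; apply/orP/idP; first by case=> /mapP[j jL [-> ->]].
  by case: s => iL; [left|right]; apply: map_f.
have [/hasP[[s z] zc fz]|/hasPn nofree] := boolP (has (fun c => free L c.1 c.2) cands).
  by exists s, z; rewrite -mem_cands.
exfalso.
pose nx (c : bool * nat) :=
  head c [seq z <- cands | (z != c) && free (remc L c.1 c.2) z.1 z.2].
have blkE (c : bool * nat) : exists E, (c \in cands) ==> (Fam E && blocked L c.1 c.2 E).
  have [cc|_] := boolP (c \in cands); last by exists eA.
  have /forallPn[E] := nofree _ cc; rewrite negb_imply negbK => h.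
  by exists E.
pose blk c := xchoose (blkE c).
have blkP s z : z \in L s -> Fam (blk (s, z)) && blocked L s z (blk (s, z)).
  by rewrite -mem_cands => zc; move/implyP: (xchooseP (blkE (s, z))); apply.
have nxP s w : w \in L s -> [&& nx (s, w) \in cands, nx (s, w) != (s, w) &
    free (remc L s w) (nx (s, w)).1 (nx (s, w)).2].
  move=> wL.
  have [e1|[s' [z [zL fz]]]] : (forall s' i, i \in remc L s w s' -> False) \/
      exists s' z, z \in remc L s w s' /\ free (remc L s w) s' z.
    have [h|h] := boolP (has predT (remc L s w true ++ remc L s w false)); last first.
      left=> s' i iL; have := hasPn h i; rewrite mem_cat.
      by case: (s') iL => ->; rewrite ?orbT => /(_ isT).
    right; apply: IH.
    - exact: leq_trans (size_remc wL) sN.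
    - by move=> s' i; rewrite /remc; case: eqP => [->|_]; rewrite ?mem_filter; [case/andP=> _|]; exact: Llv.
    by case/hasP: h => i; rewrite mem_cat => /orP[iL|iL] _; [exists true, i|exists false, i].
    (* If [w] is the only candidate, the witnesses of its block are the two ends. Then no zero fits
       on the arc and no candidate is left on the opposite one, against the last clause. *)
    have /andP[FE /(blockedP true)[z1 [l [r [ll rr [lz zr] [l2 r2] [cl cr]]]] h]] := blkP _ _ wL.
    have noL i : i \in L s -> i = w.
      by move=> iL; apply/eqP/negPn/negP => iw; apply: (e1 s i); rewrite /remc eqxx mem_filter iw.
    exfalso; have l0 : l = lo true s.
      by move: ll; rewrite inE => /orP[/eqP//|/noL h']; rewrite h' ltd_irr in lz.
    have rm : r = hi true s.
      by move: rr; rewrite inE => /orP[/eqP//|/noL h']; rewrite h' ltd_irr in zr.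
    rewrite {}l0 {}rm in l2 r2 cl cr lz zr.
    case: h => [/haszeroP[i im i0]|[y yL _]]; last by apply: (e1 (~~ s) y); rewrite remcN.
    have [i00|i00] := posnP i; first by rewrite i00 l2 in i0.
    have [im'|im'] := eqVneq i (m s); first by rewrite im' r2 in i0.
    have [iw|iw|iw] := ltngtP i w; last by rewrite iw z1 in i0.
      by move/conP: cl => /(_ i); rewrite i0 /lo; move: i00 iw; clear; lia.
    by move/conP: cr => /(_ i); rewrite i0 /hi; move: im im' iw; clear; lia.
  have zL' : z \in L s' by move: zL; rewrite /remc; case: eqP => // _; rewrite mem_filter => /andP[].
  have zw : (s', z) != (s, w).
    apply/eqP => -[ss zz]; move: zL; rewrite /remc ss zz eqxx mem_filter eqxx.
    by [].
  have : (s', z) \in [seq z <- cands | (z != (s, w)) && free (remc L s w) z.1 z.2].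
    by rewrite mem_filter zw fz mem_cands.
  rewrite /nx /=; case E: [seq _ <- _ | _] => [//|c cs] _ /=.
  have : c \in c :: cs by rewrite mem_head.
  by rewrite -E mem_filter => /andP[/andP[-> ->] ->].
apply: (@stuck_false L nx blk) u0L => //.
- move=> s w wL; have /and3P[h _ _] := nxP s w wL.
  by rewrite -mem_cands -surjective_pairing.
- by move=> s w wL; have /and3P[] := nxP s w wL.
- by move=> s w E wL FE; have /and3P[_ _ /forallP/(_ E)] := nxP s w wL; rewrite FE.
- by move=> s z zL; case/andP: (blkP s z zL).
by move=> s z zL; case/andP: (blkP s z zL).
Qed.

End Words.
(** * Positions and crossings *)

Section Cyclic.

Variable n : nat.
Implicit Types (a b i j w x y z : 'I_n) (X Y K E F : {set 'I_n}).

Definition pos i x : nat := (x + (n - i)) %% n.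

Lemma cyc_ltE i x y : cyc_lt i x y = (pos i x < pos i y). Proof. by []. Qed.

(** Removes the remainder, so that questions of cyclic order become linear arithmetic. *)
Lemma posP i x : i <= x /\ pos i x + i = x \/ x < i /\ pos i x + i = x + n.
Proof.
rewrite /pos; have := ltn_ord i; have := ltn_ord x; case: (leqP i x) => ix xn yn; [left|right].
  by rewrite (_ : x + (n - i) = x - i + n); [rewrite modnDr modn_small|]; lia.
by rewrite modn_small; lia.
Qed.

Lemma pos_lt i x : pos i x < n.
Proof. by rewrite ltn_mod; case: n i => // -[]. Qed.

Lemma pos_self i : pos i i = 0.
Proof. by have := posP i i; have := ltn_ord i; lia. Qed.

Lemma pos_inj i : injective (pos i).
Proof.
move=> x y h; apply/val_inj => /=; have := posP i x; have := posP i y; rewrite h.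
by have := ltn_ord x; have := ltn_ord y; clear; lia.
Qed.

Lemma ord_gt0 i : 0 < n. Proof. by case: n i => // -[]. Qed.

Definition at_pos i (p : nat) : 'I_n := Ordinal (ltn_pmod (i + p) (ord_gt0 i)).

Lemma at_posK i p : p < n -> pos i (at_pos i p) = p.
Proof.
move=> pn; have := posP i (at_pos i p); have := pos_lt i (at_pos i p); have := ltn_ord i => hi /=.
case: (ltnP (i + p) n) => h; first by rewrite modn_small //; lia.
have -> : (i + p) %% n = i + p - n.
  by rewrite -{1}(subnK h) modnDr modn_small //; lia.
by lia.
Qed.

Lemma posK i x : at_pos i (pos i x) = x.
Proof. by apply: (@pos_inj i); rewrite at_posK // pos_lt. Qed.

Lemma pos_shift i j x : pos j x = if pos i x + pos j i < n then pos i x + pos j i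
  else pos i x + pos j i - n.
Proof.
have := ltn_ord x; have := ltn_ord j; have := ltn_ord i.
have := posP i x; have := posP j x; have := posP j i; clear.
by case: ifP; lia.
Qed.

Lemma pos_gt0 i x : x != i -> 0 < pos i x.
Proof. by move=> xi; rewrite lt0n -(pos_self i); apply/eqP => /pos_inj/eqP; apply/negP. Qed.

(** The obstruction to separation: four alternating points in cyclic order, read from the first of
    them, so that no starting index has to be chosen. *)
Definition cross X Y := exists w x y z,
  [/\ w \in X :\: Y, x \in Y :\: X, y \in X :\: Y, z \in Y :\: X &
      pos w x < pos w y < pos w z].

Lemma rebase i w x y z : pos i w < pos i x -> pos i x < pos i y -> pos i y < pos i z ->
  pos w x < pos w y < pos w z.
Proof.
have := ltn_ord w; have := ltn_ord x; have := ltn_ord y; have := ltn_ord z; have := ltn_ord i.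
have := posP i w; have := posP i x; have := posP i y; have := posP i z.
have := posP w x; have := posP w y; have := posP w z; clear; lia.
Qed.

Lemma cross_base i X Y w x y z : w \in X :\: Y -> x \in Y :\: X -> y \in X :\: Y ->
  z \in Y :\: X -> pos i w < pos i x -> pos i x < pos i y -> pos i y < pos i z -> cross X Y.
Proof. by move=> hw hx hy hz h1 h2 h3; exists w, x, y, z; split=> //; exact: rebase h1 h2 h3. Qed.

Lemma pos_rot w x y z : w != x -> pos w x < pos w y < pos w z -> pos x y < pos x z < pos x w.
Proof.
move=> wx; have : (w : nat) <> x by move/eqP: wx => h h'; apply: h; apply: val_inj.
have := ltn_ord w; have := ltn_ord x; have := ltn_ord y; have := ltn_ord z.
have := posP w x; have := posP w y; have := posP w z; have := posP x w; have := posP x y.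
by have := posP x z; clear; lia.
Qed.

Lemma setD_neq X Y w x : w \in X :\: Y -> x \in Y :\: X -> w != x.
Proof. by rewrite !inE => /andP[wY _] /andP[_ xY]; apply: contraNneq wY => ->. Qed.

Lemma cross_sym X Y : cross X Y -> cross Y X.
Proof.
move=> [w [x [y [z [hw hx hy hz h]]]]]; exists x, y, z, w; split=> //.
exact: pos_rot (setD_neq hw hx) h.
Qed.

Lemma cross_compl X Y : cross (~: X) (~: Y) -> cross X Y.
Proof.
move=> [w [x [y [z [hw hx hy hz h]]]]]; apply: cross_sym; exists w, x, y, z.
by move: hw hx hy hz; rewrite !inE !negbK => *; split=> //; rewrite andbC.
Qed.

Lemma cyc_beforeP i X Y :
  reflect (forall x y, x \in X :\: Y -> y \in Y :\: X -> pos i x < pos i y) (cyc_before i X Y).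
Proof.
apply: (iffP forall_inP) => [H x y hx hy|H x hx].
  by have /forall_inP := H _ hx; apply.
by apply/forall_inP => y; apply: H.
Qed.

Lemma before_ncross i X Y : cyc_before i X Y -> ~ cross X Y.
Proof.
move=> /cyc_beforeP H [w [x [y [z [hw hx hy hz h]]]]].
have h1 := H _ _ hw hx; have h2 := H _ _ hy hx; have h3 := H _ _ hw hz; have h4 := H _ _ hy hz.
move: h h1 h2 h3 h4; have := ltn_ord i.
have := ltn_ord w; have := ltn_ord x; have := ltn_ord y; have := ltn_ord z.
have := posP i w; have := posP i x; have := posP i y; have := posP i z.
have := posP w x; have := posP w y; have := posP w z; clear; lia.
Qed.

Lemma separated_ncross X Y : separated X Y -> ~ cross X Y.
Proof. by case/existsP => i; apply: before_ncross. Qed.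

(** An element [y] before [x] would give the crossing [i], [y], [x], [y0]. *)
Lemma ncross_before i X Y : ~ cross X Y -> i \in X :\: Y ->
  (exists2 y, y \in Y :\: X & forall x, x \in X :\: Y -> pos i x < pos i y) -> cyc_before i X Y.
Proof.
move=> nc iX [y0 hy0 last]; apply/cyc_beforeP => x y hx hy.
rewrite ltnNge; apply/negP => h; apply: nc.
have yx : pos i y < pos i x.
  by rewrite ltn_neqAle h andbT; apply: contraNneq (setD_neq hx hy) => /pos_inj->.
apply: (@cross_base i _ _ i y x y0) => //; last exact: last.
by rewrite pos_self pos_gt0 // eq_sym (setD_neq iX hy).
Qed.

Lemma separatedP X Y : 0 < n -> separated X Y <-> ~ cross X Y.
Proof.
move=> n0; split; first exact: separated_ncross.
move=> nc; apply/existsP.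
have [e1|[x0 hx0]] := set_0Vmem (X :\: Y).
  by exists (Ordinal n0); apply/cyc_beforeP => x y; rewrite e1 in_set0.
have [e2|[y0 hy0]] := set_0Vmem (Y :\: X).
  by exists (Ordinal n0); apply/cyc_beforeP => x y; rewrite e2 in_set0.
(* start at the first element of X - Y after y0 *)
case: (arg_minnP (pos y0) hx0) => i hi imin.
exists i; apply: ncross_before => //; exists y0 => // x hx.
have := imin x hx; have := pos_lt y0 x; have := pos_lt y0 i.
have iy : (i : nat) <> y0.
  by move=> h; have := setD_neq hi hy0; rewrite (val_inj h : i = y0) eqxx.
have xy : (x : nat) <> y0.
  by move=> h; have := setD_neq hx hy0; rewrite (val_inj h : x = y0) eqxx.
have := ltn_ord i; have := ltn_ord y0; have := ltn_ord x.
have := posP i x; have := posP i y0; have := posP y0 x; have := posP y0 i.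
by move: iy xy; clear; lia.
Qed.

Lemma separated_sym X Y : separated X Y -> separated Y X.
Proof.
move=> s; have n0 : 0 < n by case/existsP: s => i _; exact: ord_gt0 i.
by apply/(separatedP _ _ n0) => c; move/(separatedP _ _ n0): s; apply; exact: cross_sym.
Qed.

End Cyclic.

(** * Sets that cross neither of two sets differing in one element *)

Section Local.
Variable n : nat.
Implicit Types (a b i j w x y z : 'I_n) (X Y K E F : {set 'I_n}).

Lemma pos_neq i x y : x != y -> pos i x != pos i y.
Proof. by apply: contraNneq => /pos_inj->. Qed.

Lemma card_diff K E : #|E| = #|K|.+1 -> #|E :\: K| = #|K :\: E|.+1.
Proof. by have := cardsID K E; have := cardsID E K; rewrite setIC; lia. Qed.

(** Having two elements outside [K], the set [E] misses some [k] of [K]. Wherever [k] lies relative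
    to [x] and [z], it yields a crossing with [K] plus [a] or [K] plus [b]. *)
Lemma cross_ends a b K E x z : a != b -> a \notin K -> b \notin K -> #|E| = #|K|.+1 ->
  ~ cross (a |: K) E -> ~ cross (b |: K) E -> a \notin E -> b \notin E ->
  x \in E :\: K -> z \in E :\: K -> pos a x < pos a b -> pos a b < pos a z -> False.
Proof.
move=> ab aK bK cE nA nB aE bE hx hz xb bz.
have xz : x != z by apply/eqP => h; move: xb; rewrite h ltnNge (ltnW bz).
have : 0 < #|K :\: E|.
  rewrite -ltnS -(card_diff cE) (cardD1 x) hx (cardD1 z) !inE eq_sym xz -in_setD hz /=.
  by rewrite add1n.
case/card_gt0P => k hk.
have [kE kK] : k \notin E /\ k \in K by move: hk; rewrite !inE => /andP[].
have ka : k != a by apply: contraNneq aK => <-.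
have kb : k != b by apply: contraNneq bK => <-.
have [xE xK] : x \in E /\ x \notin K by move: hx; rewrite !inE => /andP[].
have [zE zK] : z \in E /\ z \notin K by move: hz; rewrite !inE => /andP[].
have xa : x != a by apply: contraNneq aE => <-.
have za : z != a by apply: contraNneq aE => <-.
have xb' : x != b by apply: contraNneq bE => <-.
have zb' : z != b by apply: contraNneq bE => <-.
have kx : k != x by apply: contraNneq kE => ->.
have kz : k != z by apply: contraNneq kE => ->.
have hA u : u \in E -> u \notin K -> u != a -> u \in E :\: (a |: K) by rewrite !inE => -> /negbTE-> /negbTE->.
have hB u : u \in E -> u \notin K -> u != b -> u \in E :\: (b |: K) by rewrite !inE => -> /negbTE-> /negbTE->.
have kA : k \in (a |: K) :\: E by rewrite !inE kE kK orbT.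
have kB : k \in (b |: K) :\: E by rewrite !inE kE kK orbT.
have aA : a \in (a |: K) :\: E by rewrite !inE aE eqxx.
have bB : b \in (b |: K) :\: E by rewrite !inE bE eqxx.
have p0 : pos a x > 0 by exact: pos_gt0.
have pa : pos a a = 0 := pos_self a.
have nkx := pos_neq a kx; have nkz := pos_neq a kz; have nkb := pos_neq a kb.
have [h|h] := ltnP (pos a k) (pos a x).
  by apply: nB; apply: (@cross_base _ a _ _ k x b z) => //; apply: hB.
have [h'|h'] := ltnP (pos a k) (pos a z).
  by apply: nA; apply: (@cross_base _ a _ _ a x k z) => //; [exact: hA|exact: hA|rewrite pa|rewrite ltn_neqAle eq_sym nkx].
apply: nB; apply: cross_sym.
by apply: (@cross_base _ a _ _ x b z k) => //; [exact: hB|exact: hB|rewrite ltn_neqAle eq_sym nkz].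
Qed.

(** Complementation preserves the whole situation and exchanges the roles of [a] and [b], so
    statements about one arc carry over to their duals. *)
Lemma compl_data a b K E : a != b -> a \notin K -> b \notin K -> #|E| = #|K|.+1 ->
  let K' := ~: (a |: (b |: K)) in
  [/\ a \notin K', b \notin K', #|~: E| = #|K'|.+1, b |: K' = ~: (a |: K) & a |: K' = ~: (b |: K)].
Proof.
move=> ab aK bK cE K'; split.
- by rewrite !inE eqxx.
- by rewrite !inE eqxx orbT.
- have := cardsC E; have := cardsC (a |: (b |: K)); rewrite -/K' !cardsU1 !inE.
  by rewrite (negbTE ab) (negbTE aK) bK cE /= => <-; rewrite !(add1n, addSn) => /eqP; rewrite eqSS -addnS eqn_add2l => /eqP.
- apply/setP => u; rewrite !inE; have [->|ub] := eqVneq u b; last by [].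
  by rewrite eq_sym (negbTE ab) (negbTE bK).
by apply/setP => u; rewrite !inE; have [->|ua] := eqVneq u a; rewrite ?(negbTE ab) ?(negbTE aK).
Qed.

Lemma cross_minus a b K E x z : a != b -> a \notin K -> b \notin K -> #|E| = #|K|.+1 ->
  ~ cross (a |: K) E -> ~ cross (b |: K) E -> a \in E -> b \in E ->
  x \in K :\: E -> z \in K :\: E -> pos a x < pos a b -> pos a b < pos a z -> False.
Proof.
move=> ab aK bK cE nA nB aE bE hx hz xb bz.
have [aK' bK' cE' eA eB] := compl_data ab aK bK cE.
have hE u : u \in K :\: E -> u \in ~: E :\: ~: (a |: (b |: K)).
  by rewrite !inE negbK => /andP[-> ->]; rewrite !orbT.
apply: (cross_ends (x := x) (z := z) ab aK' bK' cE' _ _ _ _ (hE _ hx) (hE _ hz) xb bz).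
- by rewrite eB => /cross_compl.
- by rewrite eA => /cross_compl.
- by rewrite inE aE.
by rewrite inE bE.
Qed.

(** Extracts from a crossing the data required by [blocked]; [l] and [r] are the elements of [E]
    outside [K] nearest to [x] on either side. *)
Lemma block_of_cross a b K E x : a != b -> a \notin K -> b \notin K -> #|E| = #|K|.+1 ->
  ~ cross (a |: K) E -> ~ cross (b |: K) E -> x \notin K -> 0 < pos a x < pos a b ->
  cross (x |: K) E ->
  [/\ x \notin E, exists l r, [/\ l \in E :\: K, r \in E :\: K,
        pos a l < pos a x, pos a x < pos a r <= pos a b &
        forall k, k \in K :\: E -> pos a l < pos a k < pos a r -> False] &
      exists k, k \in K :\: E].
Proof.
move=> ab aK bK cE nA nB xK /andP[x0 xb].
have hA u : u \in E :\: K -> u != a -> u \in E :\: (a |: K).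
  by rewrite !inE => /andP[/negbTE-> ->] /negbTE->.
have hB u : u \in E :\: K -> u != b -> u \in E :\: (b |: K).
  by rewrite !inE => /andP[/negbTE-> ->] /negbTE->.
have kA c u : u \in K :\: E -> u \in (c |: K) :\: E by rewrite !inE => /andP[-> ->]; rewrite orbT.
have pa : pos a a = 0 := pos_self a.
have minus u v : a \in E -> b \in E -> u \in K :\: E -> v \in K :\: E ->
    pos a u < pos a b -> pos a b < pos a v -> False.
  exact: cross_minus.
have bK' u : u \in K :\: E -> u != b by rewrite inE => /andP[_ uK]; apply: contraNneq bK => <-.
move=> c.
have [p1 [e1 [p2 [e2 [hp1 he1 hp2 he2 o]]]]] := c.
have eK u : u \in E :\: (x |: K) -> u \in E :\: K by rewrite !inE negb_or => /andP[/andP[_ ->] ->].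
have hpK u : u \in (x |: K) :\: E -> u != x -> u \in K :\: E by rewrite !inE => /andP[-> /orP[->|->]].
(* A crossing avoiding [x] would persist for [K] plus [a] unless it uses [a] as a point of [E], and
   likewise for [b]. Using both is excluded by [cross_minus]. *)
have [nx1|/negPn x1] := boolP (~~ ((p1 == x) || (p2 == x))).
  move: nx1; rewrite negb_or => /andP[n1 n2]; exfalso.
  have h1 := hpK _ hp1 n1; have h2 := hpK _ hp2 n2.
  have ea : (e1 == a) || (e2 == a).
    apply/negPn/negP; rewrite negb_or => /andP[g1 g2]; apply: nA; exists p1, e1, p2, e2.
    by split=> //; [exact: kA|exact: hA (eK _ he1) _|exact: kA|exact: hA (eK _ he2) _].
  have eb : (e1 == b) || (e2 == b).
    apply/negPn/negP; rewrite negb_or => /andP[g1 g2]; apply: nB; exists p1, e1, p2, e2.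
    by split=> //; [exact: kA|exact: hB (eK _ he1) _|exact: kA|exact: hB (eK _ he2) _].
  have e1E : e1 \in E by move: he1; rewrite inE => /andP[].
  have e2E : e2 \in E by move: he2; rewrite inE => /andP[].
  have o2 := pos_rot (setD_neq hp1 he1) o.
  have o3 : pos p2 e2 < pos p2 p1 < pos p2 e1 by apply: pos_rot o2; exact: setD_neq he1 hp2.
  have o4 : pos e2 p1 < pos e2 e1 < pos e2 p2 by apply: pos_rot o3; exact: setD_neq hp2 he2.
  case/orP: ea => /eqP ea.
    have {eb}/eqP eb : e2 == b by case/orP: eb => // /eqP eb; rewrite -ea eb eqxx in ab.
    rewrite ea eb in o2 e1E e2E; case/andP: o2 => o2 o2'.
    exact: minus e1E e2E h2 h1 o2 o2'.
  have {eb}/eqP eb : e1 == b by case/orP: eb => // /eqP eb; rewrite -ea eb eqxx in ab.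
  rewrite ea eb in o4 e1E e2E; case/andP: o4 => o4 o4'.
  exact: minus e2E e1E h1 h2 o4 o4'.
have {x1 p1 e1 p2 e2 hp1 he1 hp2 he2 o} [e1 [p2 [e2 [xE he1 hp2 he2 o]]]] :
    exists e1 p2 e2, [/\ x \notin E, e1 \in E :\: K, p2 \in K :\: E, e2 \in E :\: K &
      pos x e1 < pos x p2 < pos x e2].
  have o2 := pos_rot (setD_neq hp1 he1) o.
  have o3 : pos p2 e2 < pos p2 p1 < pos p2 e1 by apply: pos_rot o2; exact: setD_neq he1 hp2.
  have p12 : p1 != p2.
    by apply: contraTneq o => <-; rewrite pos_self ltn0.
  have xE u : u \in (x |: K) :\: E -> u \notin E by rewrite inE => /andP[].
  case/orP: x1 => /eqP x1.
    exists e1, p2, e2; rewrite -x1; split=> //; [exact: xE hp1|exact: eK|apply: hpK hp2 _|exact: eK].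
    by rewrite -x1 eq_sym.
  exists e2, p1, e1; rewrite -x1; split=> //; [exact: xE hp2|exact: eK|apply: hpK hp1 _|exact: eK].
  by rewrite -x1.
have xa : x != a by apply/eqP => h; move: x0; rewrite h pa.
(* If [a] is not in [E], then [e2] lies between [a] and [x]; otherwise [a], [e1], [p2], [e2] would
   be a crossing. *)
have hl : exists l, (l \in E :\: K) && (pos a l < pos a x).
  have [aE|aE] := boolP (a \in E); first by exists a; rewrite !inE aE aK pa.
  have e1a : e1 != a by apply: contraNneq aE => <-; move: he1; rewrite inE => /andP[].
  have e2a : e2 != a by apply: contraNneq aE => <-; move: he2; rewrite inE => /andP[].
  exists e2; rewrite he2 /= ltnNge; apply/negP => h; apply: nA.
  have p2a : p2 != a by apply: contraNneq aK => <-; move: hp2; rewrite inE => /andP[].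
  exists a, e1, p2, e2; split; [by rewrite !inE eqxx aE|exact: hA|exact: kA|exact: hA|].
  move: h o x0; have := pos_gt0 e1a; have := pos_gt0 e2a; have := pos_gt0 p2a.
  have := posP a x; have := posP a e1; have := posP a e2; have := posP a p2.
  have := posP x e1; have := posP x e2; have := posP x p2.
  have := ltn_ord a; have := ltn_ord x; have := ltn_ord e1; have := ltn_ord e2; have := ltn_ord p2.
  by clear; lia.
have hr : exists r, (r \in E :\: K) && (pos a x < pos a r <= pos a b).
  have [bE|bE] := boolP (b \in E); first by exists b; rewrite !inE bE bK leqnn xb.
  have e1b : e1 != b by apply: contraNneq bE => <-; move: he1; rewrite inE => /andP[].
  have e2b : e2 != b by apply: contraNneq bE => <-; move: he2; rewrite inE => /andP[].
  exists e1; rewrite he1 /=; apply/negPn/negP => h; apply: nB.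
  have p2b : p2 != b by apply: contraNneq bK => <-; move: hp2; rewrite inE => /andP[].
  exists b, e1, p2, e2; split; [by rewrite !inE eqxx bE|exact: hB|exact: kA|exact: hB|].
  move: h o x0 xb; have := pos_gt0 e1b; have := pos_gt0 e2b; have := pos_gt0 p2b.
  have : pos x e1 > 0.
    by apply: pos_gt0; apply: contraNneq xE => <-; move: he1; rewrite inE => /andP[].
  have := posP a x; have := posP a e1; have := posP a b.
  have := posP b e1; have := posP b e2; have := posP b p2.
  have := posP x e1; have := posP x e2; have := posP x p2.
  have := ltn_ord a; have := ltn_ord b; have := ltn_ord x; have := ltn_ord e1.
  have := ltn_ord e2; have := ltn_ord p2.
  by clear; lia.
case: hl => l0 hl0; case: hr => r0 hr0.
case: (@arg_maxnP _ l0 (fun l => (l \in E :\: K) && (pos a l < pos a x)) (pos a) hl0) => l /andP[hl lx] lmax.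
case: (@arg_minnP _ r0 (fun r => (r \in E :\: K) && (pos a x < pos a r <= pos a b)) (pos a) hr0) => r /andP[hr /andP[xr rb]] rmin.
split=> //; last by exists p2.
exists l, r; split; rewrite ?xr //.
move=> k hk /andP[lk kr].
have ex1 : 0 < pos x e1.
  by apply: pos_gt0; apply: contraNneq xE => <-; move: he1; rewrite inE => /andP[].
(* Between [l] and [r], the point [p2] would have [e2] or [e1] between itself and [x], a nearer
   witness. *)
have p2out : pos a p2 < pos a l \/ pos a r < pos a p2.
  have np2l := pos_neq a (setD_neq hl hp2); have np2r := pos_neq a (setD_neq hr hp2).
  have [h|h] := ltnP (pos a p2) (pos a l); first by left.
  have [h'|h'] := ltnP (pos a r) (pos a p2); first by right.
  exfalso; have [g|g] := ltnP (pos a p2) (pos a x).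
    have /andP[g1 g2] : pos a p2 < pos a e2 < pos a x.
      have := posP a x; have := posP a e2; have := posP a p2.
      have := posP x e2; have := posP x p2.
      have := ltn_ord a; have := ltn_ord x; have := ltn_ord e2; have := ltn_ord p2.
      by case/andP: o => _; move: g; clear; lia.
    by have := lmax e2; rewrite he2 g2 => /(_ isT) /=; rewrite leqNgt (leq_ltn_trans h g1).
  have /andP[g1 g2] : pos a x < pos a e1 < pos a p2.
    have := posP a x; have := posP a e1; have := posP a p2.
    have := posP x e1; have := posP x p2.
    have := ltn_ord a; have := ltn_ord x; have := ltn_ord e1; have := ltn_ord p2.
    by case/andP: o => o _; move: g o ex1; clear; lia.
  have g3 := leq_trans g2 h'.
  have := rmin e1; rewrite he1 g1 (leq_trans (ltnW g3) rb) => /(_ isT).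
  by rewrite leqNgt g3.
(* The points [l], [k], [r], [p2] give a crossing with [K] plus [a] unless [l = a], and with [K]
   plus [b] unless [r = b]. If both equalities hold, [cross_minus] applies to [k] and [p2]. *)
have [la|la] := eqVneq l a; last first.
  apply: nA; apply: cross_sym.
  have ra : r != a by apply: contraTneq xr => ->; rewrite pa.
  case: p2out => h.
    apply: cross_sym; apply: (@cross_base _ a _ _ p2 l k r) => //; [exact: kA|exact: hA|exact: kA|exact: hA].
  by apply: (@cross_base _ a _ _ l k r p2) => //; [exact: hA|exact: kA|exact: hA|exact: kA].
have lb : l != b by rewrite la.
case: p2out => h; first by move: h; rewrite la pa.
have [rb'|rb'] := eqVneq r b.
  apply: (minus k p2) => //.
  - by rewrite -la; move: hl; rewrite inE => /andP[].
  - by rewrite -rb'; move: hr; rewrite inE => /andP[].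
  - by rewrite -rb'.
  by rewrite -rb'.
apply: nB; apply: cross_sym.
by apply: (@cross_base _ a _ _ l k r p2) => //; [exact: hB|exact: kA|exact: hB|exact: kA].
Qed.

End Local.
(** * The flip *)

Section Tile.
Variables (n : nat) (a b : 'I_n) (K : {set 'I_n}) (C : {set {set 'I_n}}).
Implicit Types (x y z : 'I_n) (E F : {set 'I_n}).
Hypothesis ab : a != b.
Hypothesis aK : a \notin K.
Hypothesis bK : b \notin K.
Hypothesis Csep : forall E F, E \in C -> F \in C -> ~ cross E F.
Hypothesis Ccard : forall E, E \in C -> #|E| = #|K|.+1.
Hypothesis KaC : a |: K \in C.
Hypothesis KbC : b |: K \in C.

(* The side true is the arc from a to b; the side false is the arc from b to a with all sets
   complemented, which exchanges the two kinds of candidates. *)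
Let sa s := if s then a else b.
Let sK s := if s then K else ~: (a |: (b |: K)).
Let sE s E := if s then E else ~: E.
Let sm s := pos (sa s) (sa (~~ s)).

Definition wval s E p : nat :=
  let e := at_pos (sa s) p in
  if (p == 0) || (p == sm s) then 2 * (e \in sE s E) else 1 + (e \in sE s E) - (e \in sK s).

Definition wlive s p : Prop := 0 < p < sm s /\ at_pos (sa s) p \notin sK s.

Lemma sa_neq s : sa s != sa (~~ s). Proof. by case: s; rewrite //= eq_sym. Qed.
Lemma sa_K s : sa s \notin sK s. Proof. by case: s; rewrite //= !inE eqxx orbT. Qed.
Lemma sb_K s : sa (~~ s) \notin sK s. Proof. by case: s; rewrite //= !inE eqxx. Qed.

Lemma sKa s : sa s |: sK s = sE s (a |: K).
Proof.
case: s => //=; have [] := @compl_data n a b K (a |: K) ab aK bK => //.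
by rewrite cardsU1 aK.
Qed.

Lemma sKb s : sa (~~ s) |: sK s = sE s (b |: K).
Proof.
case: s => //=; have [] := @compl_data n a b K (a |: K) ab aK bK => //.
by rewrite cardsU1 aK.
Qed.

Lemma sE_card s E : E \in C -> #|sE s E| = #|sK s|.+1.
Proof. by case: s => /= /Ccard // cE; have [] := compl_data ab aK bK cE. Qed.

Lemma sE_cross s E F : E \in C -> F \in C -> ~ cross (sE s E) (sE s F).
Proof. by case: s => /= EC FC; [exact: Csep|move/cross_compl; exact: Csep]. Qed.

Lemma sEN s E : sE (~~ s) E = ~: sE s E.
Proof. by case: s => //=; rewrite setCK. Qed.

Lemma sKN s : sK (~~ s) = ~: (sa s |: (sa (~~ s) |: sK s)).
Proof.
case: s => //=; apply/setP => u; rewrite !inE; have [->|_] := eqVneq u a; rewrite ?(negbTE aK) ?orbT //.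
by have [->|_] := eqVneq u b; rewrite ?(negbTE bK) //= negbK.
Qed.

Lemma sm_lt s : sm s < n. Proof. exact: pos_lt. Qed.

Lemma at0 s : at_pos (sa s) 0 = sa s.
Proof. by rewrite -[RHS](posK (sa s)) pos_self. Qed.
Lemma atm s : at_pos (sa s) (sm s) = sa (~~ s).
Proof. exact: posK. Qed.

Lemma sm_add s : sm s + sm (~~ s) = n.
Proof.
rewrite /sm negbK; have := posP (sa s) (sa (~~ s)); have := posP (sa (~~ s)) (sa s).
have : (sa s : nat) <> sa (~~ s) by move=> h; have := sa_neq s; rewrite (val_inj h) eqxx.
by have := ltn_ord (sa s); have := ltn_ord (sa (~~ s)); clear; lia.
Qed.

Lemma at_other s q : q < sm (~~ s) -> at_pos (sa (~~ s)) q = at_pos (sa s) (sm s + q).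
Proof.
move=> qm; have sn := sm_add s; apply: (@pos_inj _ (sa s)); rewrite at_posK; last by lia.
by rewrite (pos_shift (sa (~~ s))) at_posK; [case: ifP; rewrite /sm /=; move: sn qm; rewrite /sm; lia|lia].
Qed.

Lemma wval_in s E p : p <= sm s -> at_pos (sa s) p \notin sK s -> 0 < p < sm s ->
  wval s E p = 1 + (at_pos (sa s) p \in sE s E).
Proof. by move=> pm /negbTE pK; rewrite /wval pK; case: ifP => [|_ _]; [lia|rewrite subn0]. Qed.

Lemma wval_lt s E F p : (wval s F p < wval s E p) =
  (at_pos (sa s) p \in sE s E :\: sE s F).
Proof.
rewrite /wval inE; case: (at_pos (sa s) p \in sE s E); case: (at_pos (sa s) p \in sE s F);
  case: (at_pos (sa s) p \in sK s); by case: ifP.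
Qed.

Lemma pos_at s p q : p < q -> q < n -> pos (sa s) (at_pos (sa s) p) < pos (sa s) (at_pos (sa s) q).
Proof. by move=> pq qn; rewrite !at_posK //; exact: ltn_trans qn. Qed.

Lemma other_lt s E F q : q < sm (~~ s) -> wval (~~ s) F q < wval (~~ s) E q ->
  at_pos (sa s) (sm s + q) \in sE s F :\: sE s E.
Proof. by move=> qm; rewrite wval_lt at_other // !sEN !inE negbK andbC. Qed.

Definition cands s : seq nat :=
  [seq p <- iota 0 (sm s) | (0 < p) && (at_pos (sa s) p \notin sK s)].

Lemma mem_cands s p : (p \in cands s) = (0 < p < sm s) && (at_pos (sa s) p \notin sK s).
Proof. by rewrite mem_filter mem_iota /=; case: (at_pos _ _ \in _); rewrite ?andbF // !andbT. Qed.

(** By [block_of_cross] a crossing would block [p]. The missing element of [K] is a value 0 if it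
    lies on the arc of [p], and a candidate of value 2 if it lies on the opposite arc. *)
Lemma free_sep s p : p \in cands s -> @free _ (mem C) sm wval cands s p ->
  forall E, E \in C -> ~ cross (at_pos (sa s) p |: sK s) (sE s E).
Proof.
rewrite mem_cands => /andP[/andP[p0 pm] pK] /forallP fr E EC c.
have := fr E; rewrite /= EC => /negP; apply; apply/(blockedP true).
have pn : p < n := ltn_trans pm (sm_lt s).
have nA : ~ cross (sa s |: sK s) (sE s E) by rewrite sKa; apply: sE_cross.
have nB : ~ cross (sa (~~ s) |: sK s) (sE s E) by rewrite sKb; apply: sE_cross.
have pp : pos (sa s) (at_pos (sa s) p) = p by rewrite at_posK.
have pr : 0 < pos (sa s) (at_pos (sa s) p) < pos (sa s) (sa (~~ s)) by rewrite pp p0.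
have [xE [l [r [hl hr lx /andP[xr rb] noK]]] [k hk]] :=
  block_of_cross (sa_neq s) (sa_K s) (sb_K s) (sE_card s EC) nA nB pK pr c.
rewrite pp in lx xr.
have v2 u : u \in sE s E :\: sK s -> wval s E (pos (sa s) u) = 2.
  by rewrite inE => /andP[/negbTE uK uE]; rewrite /wval posK uE uK; case: ifP.
split.
- by rewrite wval_in // ?p0 ?(negbTE xE) // ltnW.
- exists (pos (sa s) l), (pos (sa s) r); rewrite !v2 //; split=> //.
  + rewrite inE; case: posnP => [//|l0] /=.
    by rewrite mem_cands posK l0 (ltn_trans lx pm); move: hl; rewrite inE => /andP[->].
  + rewrite inE; move: rb; rewrite leq_eqVlt => /orP[->//|rb].
    rewrite mem_cands posK (ltn_trans p0 xr) rb /=; by move: hr; rewrite inE => /andP[-> _]; rewrite orbT.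
  + have cc u v : pos (sa s) l <= u -> u <= v -> v <= pos (sa s) r -> con wval s E u v.
      move=> lu uv vr; apply/conP => q hq; rewrite lt0n; apply/eqP => q0.
      have qn : q < n by have := pos_lt (sa s) r; move: hq vr uv; clear; lia.
      apply: (noK (at_pos (sa s) q)); last by rewrite at_posK //; move: hq lu uv vr; clear; lia.
      move: q0; rewrite /wval inE; case: ifP; last first.
        by case: (_ \in sE s E); case: (_ \in sK s).
      move/orP=> [/eqP q0|/eqP q0]; first by move: hq lu; rewrite q0; clear; lia.
      by move: hq uv vr rb; rewrite q0 /sm; clear; lia.
    by split; apply: cc => //; exact: ltnW.
have [kE kK] : k \notin sE s E /\ k \in sK s by move: hk; rewrite inE => /andP[].
have ka : k != sa s by apply: contraTneq kK => ->; exact: sa_K.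
have kb : k != sa (~~ s) by apply: contraTneq kK => ->; exact: sb_K.
have [kp|kp] := ltnP (pos (sa s) k) (sm s).
  left; apply/haszeroP; exists (pos (sa s) k); first exact: ltnW.
  by rewrite /wval posK (negbTE kE) kK; case: ifP.
right; have kb0 : 0 < pos (sa (~~ s)) k by exact: pos_gt0.
have kbm : pos (sa (~~ s)) k < sm (~~ s).
  have := sm_add s; have := pos_shift (sa (~~ s)) (sa s) k.
  rewrite -[pos (sa s) (sa (~~ s))]/(sm s); have := pos_lt (sa s) k; have := pos_lt (sa (~~ s)) k.
  have := pos_gt0 ka.
  by move: kp; clear; case: ifP; lia.
have kK' : k \notin sK (~~ s) by rewrite sKN !inE kK !orbT.
exists (pos (sa (~~ s)) k); first by rewrite mem_cands posK kb0 kbm.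
by rewrite wval_in ?posK ?kb0 ?kbm // ?sEN ?inE ?(negbTE kE) // ltnW.
Qed.

Lemma wval0 s E : wval s E 0 = 2 * (sa s \in sE s E).
Proof. by rewrite /wval eqxx at0. Qed.

Lemma wvalm s E : wval s E (sm s) = 2 * (sa (~~ s) \in sE s E).
Proof. by rewrite /wval eqxx orbT atm. Qed.

Lemma wval_cross s E F i j k l : E \in C -> F \in C -> i < j -> j < k -> k < l -> l < n ->
  at_pos (sa s) i \in sE s E :\: sE s F -> at_pos (sa s) j \in sE s F :\: sE s E ->
  at_pos (sa s) k \in sE s E :\: sE s F -> at_pos (sa s) l \in sE s F :\: sE s E -> False.
Proof.
move=> EC FC ij jk kl ln h1 h2 h3 h4; apply: (@sE_cross s E F) => //.
have kn := ltn_trans kl ln; have jn := ltn_trans jk kn.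
by apply: (cross_base h1 h2 h3 h4); apply: pos_at.
Qed.

Lemma wval_inside s p : 0 < p < sm s ->
  wval s (a |: K) p = 1 /\ wval s (b |: K) p = 1.
Proof.
move=> pm; have pn : p < n by have := sm_lt s; lia.
have ne t : pos (sa s) t != p -> at_pos (sa s) p != t by apply: contraNneq => <-; rewrite at_posK.
have pa : at_pos (sa s) p != sa s by apply: ne; rewrite pos_self; lia.
have pb : at_pos (sa s) p != sa (~~ s) by apply: ne; rewrite -/(sm s); lia.
rewrite /wval -sKa -sKb !inE (negbTE pa) (negbTE pb) /=.
by case: (_ \in sK s); case: ifP; move: pm; clear; lia.
Qed.

(** The hypotheses of [free_exists] are the absence of crossings in [C] distributed over the two
    arcs, together with [cross_ends]. *)
Lemma free_candidate : (exists s p, p \in cands s) ->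
  exists s p, p \in cands s /\ @free _ (mem C) sm wval cands s p.
Proof.
have smn := sm_lt; have sadd := sm_add.
apply: (@free_exists _ (mem C) sm wval wlive (a |: K) (b |: K)) => //.
- by move=> s E; rewrite wval0 wvalm sEN inE; case: (_ \in _).
- by move=> s E; rewrite wval0; case: (_ \in _); [right|left].
- by move=> s E i; rewrite /wval; case: (_ \in sE _ _); case: (_ \in sK s); case: ifP.
- by move=> s i [im iK]; split=> // E; rewrite wval_in //; case/andP: im => _ /ltnW.
- move=> s E F i j k l EC FC ij jk kl lm; rewrite !wval_lt => h1 h2 h3 h4.
  exact: (wval_cross EC FC ij jk kl (leq_ltn_trans lm (sm_lt s)) h1 h2 h3 h4).
- move=> s E F i j k y EC FC ij jk km /andP[y0 ym] h1 h2 h3 /(other_lt ym) h4.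
  move: h1 h2 h3; rewrite !wval_lt => h1 h2 h3.
  have lt1 : k < sm s + y by move: km y0; clear; lia.
  have lt2 : sm s + y < n by rewrite -(sm_add s) ltn_add2l.
  exact: (wval_cross EC FC ij jk lt1 lt2 h1 h2 h3 h4).
- move=> s E F i j k l EC FC i0 ij jm k0 kl lm h1 h2 /(other_lt (ltn_trans kl lm)) h3.
  move=> /(other_lt lm) h4; move: h1 h2; rewrite !wval_lt => h1 h2.
  have lt1 : j < sm s + k by move: jm; clear; lia.
  have lt2 : sm s + l < n by rewrite -(sm_add s) ltn_add2l.
  by apply: (wval_cross EC FC ij lt1 _ lt2 h1 h2 h3 h4); rewrite ltn_add2l.
- move=> s E i j EC; rewrite wval0 wvalm => a0 b0 im i2 jm; rewrite lt0n; apply/eqP => j0.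
  have aE : sa s \notin sE s E by move: a0; case: (_ \in _).
  have bE : sa (~~ s) \notin sE s E by move: b0; case: (_ \in _).
  have inn : i < n := leq_ltn_trans im (sm_lt s).
  have ip : 0 < i < sm s.
    have i0 : i <> 0 by move=> h; move: i2; rewrite h wval0 (negbTE aE).
    have im' : i <> sm s by move=> h; move: i2; rewrite h wvalm (negbTE bE).
    by move: i0 im' im; clear; lia.
  have hi : at_pos (sa s) i \in sE s E :\: sK s.
    move: i2; rewrite /wval inE; case: ifP; first by move: ip; clear; lia.
    by case: (_ \in sE s E); case: (_ \in sK s).
  have jm' : 0 < j < sm (~~ s).
    have h0 : j <> 0 by move=> h; move: j0; rewrite h wval0 sEN inE bE.
    have h1 : j <> sm (~~ s) by move=> h; move: j0; rewrite h wvalm negbK sEN inE aE.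
    by move: h0 h1 jm; clear; lia.
  have jn : sm s + j < n by rewrite -(sm_add s) ltn_add2l; case/andP: jm'.
  have hj : at_pos (sa s) (sm s + j) \in sE s E :\: sK s.
    have := at_other (proj2 (andP jm')); have := j0; rewrite /wval.
    case: ifP; first by move: jm'; clear; lia.
    move=> _; rewrite sEN sKN => + e; rewrite e !inE.
    by move: (_ \in sE s E) (_ \in sK s) (_ == _) (_ == _) => [] [] [] [].
  apply: (cross_ends (sa_neq s) (sa_K s) (sb_K s) (sE_card s EC) _ _ aE bE hi hj).
  + by rewrite sKa; apply: sE_cross.
  + by rewrite sKb; apply: sE_cross.
  + by rewrite at_posK // -/(sm s); case/andP: ip.
  by rewrite at_posK // -/(sm s); case/andP: jm' => j1 _; rewrite -[X in X < _]addn0 ltn_add2l.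
- by move=> s; rewrite wval0 wvalm -sKa !inE eqxx eq_sym (negbTE (sa_neq s)) (negbTE (sb_K s)).
- by move=> s; rewrite wval0 wvalm -sKb !inE eqxx (negbTE (sa_neq s)) (negbTE (sa_K s)).
- by move=> s i /wval_inside[].
- by move=> s i /wval_inside[].
by move=> s i; rewrite mem_cands => /andP[].
Qed.

(** A candidate of the complemented side is an element [y] of [K]; adding it there means removing it
    from [K] plus [a] and [b]. *)
Lemma tile_compatible :
  (exists2 x, x \notin K & 0 < pos a x < pos a b) \/ (exists2 y, y \in K & pos a b < pos a y) ->
  (exists x, [/\ x \notin K, 0 < pos a x < pos a b & forall E, E \in C -> ~ cross (x |: K) E]) \/
  (exists y, [/\ y \in K, pos a b < pos a y &
     forall E, E \in C -> ~ cross ((a |: (b |: K)) :\ y) E]).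
Proof.
move=> h.
have baseb y : y != b -> y != a -> (0 < pos b y < sm false) = (pos a b < pos a y).
  move=> yb ya; have := pos_gt0 yb; have := sm_add true; have := pos_gt0 ya.
  rewrite /sm /=; have := pos_lt a y; have := posP a b; have := posP b a.
  have := posP a y; have := posP b y; have := ltn_ord a; have := ltn_ord b; have := ltn_ord y.
  by clear; lia.
have /free_candidate[s [p [pL fr]]] : exists s p, p \in cands s.
  case: h => [[x xK hx]|[y yK hy]]; first by exists true, (pos a x); rewrite mem_cands posK xK hx.
  exists false, (pos b y); rewrite mem_cands posK !inE yK !orbT andbT baseb //.
    by apply: contraNneq bK => <-.
  by apply: contraNneq aK => <-.
have := free_sep pL fr; move: pL; rewrite mem_cands => /andP[pm].
have pn : p < n by have := sm_lt s; lia.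
case: s {fr} pm => /= pm pK sep.
  by left; exists (at_pos a p); rewrite at_posK.
move: pK; rewrite !inE negbK => pK; right; exists (at_pos b p).
have p0 : at_pos b p != b by apply: contraTneq pm => h'; rewrite -(at_posK b pn) h' pos_self.
have pa : at_pos b p != a.
  by apply: contraTneq pm => h'; rewrite -(at_posK b pn) h' /sm /= ltnn andbF.
move: pK; rewrite (negbTE p0) (negbTE pa) /= => pK; split=> //.
  by rewrite -baseb // at_posK.
move=> E EC c; apply: (sep E EC); apply: cross_compl; rewrite setCK.
suff -> : ~: (at_pos b p |: ~: (a |: (b |: K))) = (a |: (b |: K)) :\ at_pos b p by [].
by apply/setP => u; rewrite !inE negb_or negbK.
Qed.

End Tile.
(** * Size of the maximal separated systems of r-sets *)

Section Uniform.
Variables (n r : nat) (C : {set {set 'I_n}}).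
Implicit Types (a b i j x y z : 'I_n) (E F K X Y Z P : {set 'I_n}).
Hypothesis Csep : forall E F, E \in C -> F \in C -> ~ cross E F.
Hypothesis Ccard : forall E, E \in C -> #|E| = r.
Hypothesis Cmax : forall X, #|X| = r -> (forall E, E \in C -> ~ cross X E) -> X \in C.

Lemma flip_exists a b K : a != b -> a \notin K -> b \notin K -> a |: K \in C -> b |: K \in C ->
  (exists2 x, x \notin K & 0 < pos a x < pos a b) \/ (exists2 y, y \in K & pos a b < pos a y) ->
  (exists x, [/\ x \notin K, 0 < pos a x < pos a b & x |: K \in C]) \/
  (exists y, [/\ y \in K, pos a b < pos a y & (a |: (b |: K)) :\ y \in C]).
Proof.
move=> ab aK bK KaC KbC h.
have cK : #|K|.+1 = r by rewrite -(Ccard KaC) cardsU1 aK.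
have cC E : E \in C -> #|E| = #|K|.+1 by rewrite cK; apply: Ccard.
case: (tile_compatible ab aK bK Csep cC KaC KbC h) => [[x [xK hx sx]]|[y [yK hy sy]]].
  by left; exists x; split=> //; apply: Cmax => //; rewrite cardsU1 xK.
right; exists y; split=> //; apply: Cmax => //.
have := cardsD1 y (a |: (b |: K)); rewrite !inE yK !orbT !cardsU1 !inE negb_or ab aK bK !add1n cK.
by case=> <-.
Qed.

Definition interval i : {set 'I_n} := [set x | pos i x < r].

Lemma card_pos i m : m <= n -> #|[set x | pos i x < m]| = m.
Proof.
move=> mn; rewrite -[RHS]card_ord -(card_imset _ (f := fun k : 'I_m => at_pos i k)); last first.
  move=> k l /(congr1 (pos i)); rewrite !at_posK; first by move/val_inj.
    exact: leq_trans (ltn_ord l) mn.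
  exact: leq_trans (ltn_ord k) mn.
apply: eq_card => x; rewrite inE; apply/idP/imsetP => [h|[k _ ->]].
  by exists (Ordinal h); rewrite // posK.
by rewrite at_posK // (leq_trans (ltn_ord k)).
Qed.

Lemma interval_before i Y : cyc_before i (interval i) Y.
Proof. by apply/cyc_beforeP => x y; rewrite !inE -leqNgt => /andP[_ h] /andP[h' _]; apply: leq_trans h h'. Qed.

Hypothesis rn : r <= n.

Lemma interval_in i : interval i \in C.
Proof. by apply: Cmax => [|E _]; [exact: card_pos|exact: before_ncross (interval_before i E)]. Qed.

Definition below (j : nat) : {set 'I_n} := [set x : 'I_n | x < j].
Definition count_below (j : nat) Z := \sum_(x in Z) (x < j).

Lemma count_belowE (j : nat) Z : count_below j Z = #|Z :&: below j|.
Proof.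
rewrite -sum1_card /count_below (bigID (fun x : 'I_n => x < j)) /= [X in _ + X]big1 ?addn0 //.
  by apply: eq_big => [x|x /andP[_ ->]] //; rewrite !inE.
by move=> x /andP[_ /negbTE->].
Qed.

Lemma card_below j : #|below j| = j.
Proof.
have n0 := ord_gt0 j; rewrite -[RHS](card_pos (Ordinal n0) (ltnW (ltn_ord j))).
apply: eq_card => x; rewrite !inE; have := posP (Ordinal n0) x; have := ltn_ord x.
by move=> xn /= ?; congr (_ < _); lia.
Qed.

Lemma edge_exists j k : k < r -> k <= j -> j < n - r + k ->
  exists Z c, [/\ j \notin Z, c \notin Z, j |: Z \in C, c |: Z \in C &
    j < c /\ #|Z :&: below j| = k].
Proof.
move=> kr kj jk.
have r0 : 0 < r by case: (r) kr.
have rn' : r < n by have := ltn_ord j; move: kj kr jk rn r0; clear; lia.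
(* The two sets of the starting pair are the intervals beginning at [j] and at the next index. *)
pose Z0 := interval j :\ j; pose c0 := at_pos j r.
pose edge (Zc : {set 'I_n} * 'I_n) := [&& j \notin Zc.1, Zc.2 \notin Zc.1, Zc.2 != j,
  j |: Zc.1 \in C & Zc.2 |: Zc.1 \in C].
have pc0 : pos j c0 = r by rewrite at_posK.
have e0 : edge (Z0, c0).
  have c0j : c0 != j by apply: contraTneq r0 => h; rewrite -pc0 h pos_self.
  apply/and5P; split; rewrite ?inE ?eqxx ?c0j //=; first by rewrite pc0 ltnn.
    by rewrite setD1K ?interval_in // inE pos_self.
  have n1 : 1 < n by lia.
  suff -> : c0 |: Z0 = interval (at_pos j 1) by exact: interval_in.
  apply/setP => x; rewrite !inE -!(inj_eq (@pos_inj _ j)) pos_self pc0.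
  have := pos_shift (at_pos j 1) j x; rewrite [pos j (at_pos j 1)]at_posK //.
  have := pos_lt (at_pos j 1) x; move: rn' r0; clear.
  by case: ifP => *; apply/idP/idP; lia.
have [k0|k0] := posnP k.
  have cj : j < c0.
    by have := posP j c0; rewrite pc0; have := ltn_ord c0; move: jk rn' r0; rewrite k0; clear; lia.
  exists Z0, c0; case/and5P: e0 => /= ? ? ? ? ?; split=> //; split=> //.
  rewrite k0; apply/eqP; rewrite cards_eq0; apply/eqP/setP => x; rewrite !inE.
  apply/negP => /andP[/andP[_ h]]; apply/negP; rewrite -leqNgt.
  by have := posP j x; move: h jk; rewrite k0; clear; lia.
(* Only the part of the interval that wraps around lies below [j]; it has at most [r + j - n]
   elements. *)
have t0 : count_below j Z0 < k.
  rewrite count_belowE; have m0 : r + j - n <= n by have := ltn_ord j; move: rn'; clear; lia.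
  have n0 := ord_gt0 j; apply: (@leq_ltn_trans (r + j - n)); last by move: jk k0 rn'; clear; lia.
  rewrite -(card_pos (Ordinal n0) m0); apply/subset_leq_card/subsetP => x; rewrite !inE.
  have := posP j x; have := posP (Ordinal n0) x => /=; have := ltn_ord x.
  by move=> ? ? ? /andP[/andP[_ ?]]; lia.
(* A flip that puts [c] into [Z] in place of [y] raises the sum by the same amount by which the last
   term drops. The factor 2 makes the total increase. *)
pose pot (Zc : {set 'I_n} * 'I_n) := 2 * (\sum_(x in Zc.1) pos j x) + pos j Zc.2.
have h0 : edge (Z0, c0) && (count_below j (Z0, c0).1 < k) by rewrite e0.
(* Among pairs with fewer than [k] elements below [j], one of maximal potential is taken, so that
   the next flip must reach [k]. *)
case: (@arg_maxnP _ _ (fun Zc => edge Zc && (count_below j Zc.1 < k)) pot h0) => -[Z c].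
move=> /andP[/and5P[/= jZ cZ cj jC cC] tZ] mx.
have pcj x : 0 < pos j x -> (0 < pos c x < pos c j) = (pos j c < pos j x).
  move=> px; have := pos_gt0 cj; have := pos_shift c j x; have := pos_shift c j j; rewrite pos_self.
  have := pos_lt j c; have := pos_lt j x; have := pos_lt c x; have := pos_lt c j; move: px; clear.
  by do 2 case: ifP; lia.
have pcj' x : 0 < pos j x -> (pos c j < pos c x) = (pos j x < pos j c).
  move=> px; have := pos_gt0 cj; have := pos_shift c j x; have := pos_shift c j j; rewrite pos_self.
  have := pos_lt j c; have := pos_lt j x; have := pos_lt c x; have := pos_lt c j; move: px; clear.
  by do 2 case: ifP; lia.
have Zj x : x \in Z -> x != j by apply: contraTneq => ->.
(* Without candidates [Z] contains everything below [j], if [j < c], or lies entirely below [j].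
   Either way it has at least [k] elements there. *)
have nt : (exists2 x, x \notin Z & 0 < pos c x < pos c j) \/ (exists2 y, y \in Z & pos c j < pos c y).
  have [/existsP[x /andP[xZ hx]]|nx] := boolP [exists x, (x \notin Z) && (0 < pos c x < pos c j)].
    by left; exists x.
  have [/existsP[y /andP[yZ hy]]|ny] := boolP [exists y, (y \in Z) && (pos c j < pos c y)].
    by right; exists y.
  exfalso; move: tZ; apply/negP; rewrite -leqNgt count_belowE.
  have [cj'|cj'] := ltnP j c.
    apply: leq_trans kj _; rewrite -{1}(card_below j) subset_leq_card // subsetI subxx andbT.
    apply/subsetP => x; rewrite inE => xj; apply/negPn/negP => xZ.
    case/negP: nx; apply/existsP; exists x; rewrite xZ pcj.
      have := posP j x; have := posP j c; have := ltn_ord c; move: xj cj'; clear; lia.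
    by apply: pos_gt0; apply: contraTneq xj => ->; rewrite ltnn.
  have cj2 : c < j by rewrite ltn_neqAle cj' andbT.
  have -> : Z :&: below j = Z.
    apply/setIidPl/subsetP => y yZ; rewrite inE ltnNge; apply/negP => jy.
    case/negP: ny; apply/existsP; exists y; rewrite yZ pcj' ?pos_gt0 ?Zj //.
    by have := posP j y; have := posP j c; have := ltn_ord y; move: jy cj2; clear; lia.
  by rewrite -ltnS; move: kr; rewrite -(Ccard cC) cardsU1 cZ.
case: (flip_exists cj cZ jZ cC jC nt) => [[x [xZ hx xC]]|[y [yZ hy yC]]].
  exfalso; have xj : x != j by apply: contraTneq hx => ->; rewrite ltnn andbF.
  have := mx (Z, x); rewrite /edge /= jZ xZ xj jC xC tZ => /(_ isT); rewrite /pot /= leq_add2l.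
  by apply/negP; rewrite -ltnNge -pcj // pos_gt0.
have yj := Zj _ yZ; have yc : y != c by apply: contraNneq cZ => <-.
have y0 := pos_gt0 yj; rewrite pcj' // in hy.
pose Z' := (c |: Z) :\ y.
have eZ' : edge (Z', y).
  have jZ' : j \notin Z' by rewrite !inE (eq_sym j c) (negbTE cj) (negbTE jZ) andbF.
  apply/and5P; split=> //=; first by rewrite !inE eqxx.
    suff -> : j |: Z' = (c |: (j |: Z)) :\ y by [].
    apply/setP => x; rewrite !inE; have [->|_] := eqVneq x j; last by [].
    by rewrite (eq_sym j y) yj orbT.
  by rewrite /Z' setD1K // !inE yZ orbT.
have sumZ' (f : 'I_n -> nat) : \sum_(x in Z') f x + f y = \sum_(x in Z) f x + f c.
  rewrite addnC -big_setD1 /=; last by rewrite !inE yZ orbT.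
  by rewrite big_setU1 //= addnC.
have t' : k <= count_below j Z'.
  rewrite leqNgt; apply/negP => h; have := mx (Z', y); rewrite eZ' h => /(_ isT).
  rewrite /pot /=; have := sumZ' (pos j); move: hy; clear; set A := \sum_(x in Z') _; set B := \sum_(x in Z) _; move: A B => A B; lia.
case/and5P: eZ' => /= h1 h2 h3 h4 h5; exists Z', y; split=> //.
(* The exchange adds at most one to the count below [j]. So the count becomes exactly [k], and the
   removed [y] lies above [j]. *)
have := sumZ' (fun x => x < j); rewrite -[\sum_(x in Z') _]/(count_below j Z').
rewrite -[\sum_(x in Z) _]/(count_below j Z) -count_belowE.
have : (y : nat) <> j by move=> h; case/eqP: yj; apply: val_inj.
by move: tZ t'; clear; lia.
Qed.

(** * Counting traces on initial segments *)

Definition traces (j : nat) : {set {set 'I_n}} := [set X :&: below j | X in C].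

Definition both j : {set {set 'I_n}} :=
  [set X :&: below j | X in C & j \notin X] :&: [set X :&: below j | X in C & j \in X].

Lemma below_succ j : below j.+1 = j |: below j.
Proof. by apply/setP => x; rewrite !inE ltnS leq_eqVlt. Qed.

Lemma card_traces_succ j : #|traces j.+1| = #|traces j| + #|both j|.
Proof.
set A := [set X :&: below j | X in C & j \notin X].
set B := [set X :&: below j | X in C & j \in X].
have jb P : P \in A :|: B -> j \notin P.
  by rewrite inE => /orP[] /imsetP[X _ ->]; rewrite !inE ltnn andbF.
have -> : traces j = A :|: B.
  apply/setP => P; rewrite inE; apply/imsetP/orP => [[X XC ->]|].
    by have [jX|jX] := boolP (j \in X); [right|left]; apply/imsetP; exists X; rewrite // inE XC.
  by case=> /imsetP[X]; rewrite inE => /andP[XC _] ->; exists X.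
have -> : traces j.+1 = A :|: [set j |: P | P in B].
  apply/setP => P; rewrite inE /traces below_succ; apply/imsetP/orP => [[X XC ->]|].
    have [jX|jX] := boolP (j \in X); [right|left].
      apply/imsetP; exists (X :&: below j); first by apply/imsetP; exists X; rewrite // inE XC.
      by rewrite setIUr (setIidPr _) // sub1set.
    apply/imsetP; exists X; first by rewrite inE XC.
    by apply/setP => x; rewrite !inE; have [->|//] := eqVneq x j; rewrite (negbTE jX).
  case=> [/imsetP[X]|/imsetP[Q /imsetP[X]]]; rewrite inE => /andP[XC jX] ->.
    exists X => //; apply/setP => x; rewrite !inE; have [->|//] := eqVneq x j.
    by rewrite (negbTE jX).
  by move=> ->; exists X => //; rewrite setIUr (@setIidPr _ X [set j] _) ?sub1set.
have -> : #|A :|: [set j |: P | P in B]| = #|A| + #|B|.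
  rewrite cardsU disjoint_setI0 ?cards0 ?subn0.
    congr (_ + _); apply: card_in_imset => P Q hP hQ /(congr1 (fun R => R :\ j)).
    by rewrite !setU1K // jb // inE (hP, hQ) orbT.
  apply/pred0P => P; apply/negbTE/negP => /andP[/= PA /imsetP[Q _ e]].
  by have := jb P; rewrite inE PA e !inE eqxx => /(_ isT).
by rewrite cardsU /both -/A -/B subnK // (leq_trans (subset_leq_card (subsetIl _ _))) ?leq_addr.
Qed.

Lemma card_split E j : #|E| = #|E :&: below j| + #|E :\: below j|.
Proof. by rewrite cardsID. Qed.

Lemma bothP j P : P \in both j -> exists X Y, [/\ X \in C, Y \in C, j \notin X, j \in Y &
  P = X :&: below j /\ P = Y :&: below j].
Proof.
rewrite inE => /andP[/imsetP[X]]; rewrite inE => /andP[XC jX] e.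
by case/imsetP=> Y; rewrite inE => /andP[YC jY] e'; exists X, Y.
Qed.

Lemma both_size j P : P \in both j -> #|P| < r /\ #|P| <= j < n - r + #|P|.
Proof.
case/bothP => X [Y [XC YC jX jY [eX eY]]]; split.
  rewrite -(Ccard YC) (card_split Y j) -eY -[X in X < _]addn0 ltn_add2l card_gt0.
  by apply/set0Pn; exists j; rewrite !inE ltnn.
apply/andP; split; first by rewrite eX -{2}(card_below j) subset_leq_card // subsetIr.
have h : #|X :\: below j| < n - j.
  have sub : j |: (X :\: below j) \subset ~: below j.
    by apply/subsetP => x; rewrite !inE => /orP[/eqP->|/andP[]] //; rewrite ltnn.
  have := subset_leq_card sub; rewrite [X in _ <= X]cardsCs setCK card_ord card_below.
  by rewrite cardsU1 !inE (negbTE jX) andbF add1n.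
by have := Ccard XC; rewrite (card_split X j) -eX; have := ltn_ord j; move: h; clear; lia.
Qed.

(** Since [Y] contains [j] and [X] does not, equal sizes give [X] an element [z] above [j] outside
    [Y]. An inversion would then yield the crossing [y], [x], [j], [z]. *)
Lemma both_before j X Y x y : X \in C -> Y \in C -> j \notin X -> j \in Y ->
  #|X :&: below j| = #|Y :&: below j| ->
  x \in (X :&: below j) :\: (Y :&: below j) -> y \in (Y :&: below j) :\: (X :&: below j) ->
  x < y.
Proof.
move=> XC YC jX jY e; rewrite !inE => /andP[xY /andP[xX xj]] /andP[yX /andP[yY yj]].
rewrite xj andbT in xY; rewrite yj andbT in yX.
rewrite ltnNge; apply/negP => yx; have n0 := ord_gt0 j.
have [z zX /andP[zY jz]] : exists2 z, z \in X & (z \notin Y) && (j < z).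
  apply/exists_inP; apply: contraT; rewrite negb_exists_in => /forall_inP h.
  have sub : j |: (X :\: below j) \subset Y :\: below j.
    apply/subsetP => z; rewrite !inE => /orP[/eqP->|/andP[zj zX]]; first by rewrite jY ltnn.
    have := h z zX; rewrite zj negb_and negbK -leqNgt => /orP[->//|zj'].
    by case/negP: jX; rewrite (_ : j = z) //; apply: val_inj; move: zj zj'; rewrite -leqNgt /=; clear; lia.
  have := subset_leq_card sub; rewrite cardsU1 !inE (negbTE jX) andbF.
  have := Ccard XC; rewrite -(Ccard YC) (card_split X j) (card_split Y j) e => /eqP.
  by rewrite eqn_add2l => /eqP ->; rewrite add1n ltnn.
apply: (Csep YC XC); apply: (@cross_base _ (Ordinal n0) _ _ y x j z); rewrite ?inE ?yY ?yX ?xX ?xY ?jY ?jX ?zX ?zY //.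
- have : (x : nat) <> y by move=> h; case/negP: xY; rewrite (val_inj h).
  have := posP (Ordinal n0) x; have := posP (Ordinal n0) y; move: yx => /=; clear; lia.
- have := posP (Ordinal n0) x; have := posP (Ordinal n0) j; move: xj => /=; clear; lia.
by have := posP (Ordinal n0) z; have := posP (Ordinal n0) j; move: jz => /=; clear; lia.
Qed.

(** Each of the two traces comes from a set with [j] and from one without, so [both_before] applies
    in both orders and the two conclusions exclude each other. *)
Lemma both_inj j P Q : P \in both j -> Q \in both j -> #|P| = #|Q| -> P = Q.
Proof.
move=> /bothP[X [Y [XC YC jX jY [eX eY]]]] /bothP[X' [Y' [XC' YC' jX' jY' [eX' eY']]]] e.
have h1 x y : x \in P :\: Q -> y \in Q :\: P -> x < y.
  by rewrite eX eY'; apply: both_before => //; rewrite -eX -eY'.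
have h2 x y : x \in P :\: Q -> y \in Q :\: P -> y < x.
  by rewrite eX' eY => hx hy; apply: both_before hy hx => //; rewrite -eX' -eY.
have [PQ|[x hx]] := set_0Vmem (P :\: Q).
  by apply/eqP; rewrite eqEcard e leqnn andbT -setD_eq0 PQ.
have [QP|[y hy]] := set_0Vmem (Q :\: P).
  by apply/esym/eqP; rewrite eqEcard e leqnn andbT -setD_eq0 QP.
by have := h1 _ _ hx hy; rewrite ltnNge ltnW // h2.
Qed.

Lemma both_exists j k : k < r -> k <= j < n - r + k -> exists2 P, P \in both j & #|P| = k.
Proof.
move=> kr /andP[kj jk]; have [Z [c [jZ cZ jC cC [jc cZk]]]] := edge_exists kr kj jk.
exists (Z :&: below j) => //; rewrite inE; apply/andP; split; apply/imsetP.
  exists (c |: Z); first by rewrite !inE cC (negbTE jZ) orbF neq_ltn jc.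
  apply/setP => x; rewrite !inE; have [->|//] := eqVneq x c.
  by rewrite ltnNge (ltnW jc) andbF.
exists (j |: Z); first by rewrite !inE jC eqxx.
by apply/setP => x; rewrite !inE; have [->|//] := eqVneq x j; rewrite ltnn !andbF.
Qed.

Lemma card_both j : #|both j| = \sum_(k < r) (k <= j < n - r + k).
Proof.
have [r0|r0] := posnP r.
  rewrite [RHS]big1 => [|k _]; last by have := ltn_ord k; rewrite {2}r0.
  by apply/eqP; rewrite cards_eq0; apply/eqP/setP => P; rewrite in_set0; apply/negP => /both_size[]; rewrite r0.
(* The remainder only makes the value a member of ['I_r]; the sizes of members of [both j] are
   already below [r]. *)
pose f (P : {set 'I_n}) : 'I_r := Ordinal (ltn_pmod #|P| r0).
have fE P : P \in both j -> f P = #|P| :> nat by move=> /both_size[h _] /=; rewrite modn_small.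
rewrite -(card_in_imset (f := f)); last first.
  by move=> P Q hP hQ e; apply: (both_inj hP hQ); rewrite -!fE // e.
rewrite -sum1_card big_mkcond /=; apply: eq_bigr => k _; case: imsetP => [[P hP ->]|h].
  by have [_] := both_size hP; rewrite fE // => ->.
apply/esym/eqP; rewrite eqb0; apply/negP => h'; case: h; have [P hP cP] := both_exists (ltn_ord k) h'.
by exists P => //; apply: ord_inj; rewrite fE ?cP.
Qed.

Lemma card_traces0 : 0 < n -> #|traces 0| = 1.
Proof.
move=> n0; apply/eqP/cards1P; exists set0; apply/setP => P; rewrite inE.
have e0 X : X :&: below 0 = set0 by apply/setP => x; rewrite !inE ltn0 andbF.
apply/imsetP/eqP => [[X _ ->]|->]; first exact: e0.
by exists (interval (Ordinal n0)); rewrite ?interval_in // e0.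
Qed.

Lemma card_maximal : 0 < n -> #|C| = r * (n - r) + 1.
Proof.
move=> n0; have -> : #|C| = #|traces n|.
  rewrite -[in LHS](imset_id C); congr #|pred_of_set _|; apply: eq_imset => X.
  by apply/setP => x; rewrite !inE ltn_ord andbT.
have h m : m <= n -> #|traces m| = 1 + \sum_(j < m) \sum_(k < r) (k <= j < n - r + k).
  elim: m => [|m IH] mn; first by rewrite big_ord0 addn0 card_traces0.
  rewrite big_ord_recr /= addnA -IH ?(ltnW mn) //.
  by rewrite (card_traces_succ (Ordinal mn)) card_both.
(* After exchanging the sums, each [k] is counted for the [n - r] values of [j] starting at [k]. *)
rewrite h // addnC exchange_big /=; congr (_ + 1).
rewrite (eq_bigr (fun=> n - r)) ?sum_nat_const ?card_ord // => k _.
have n0k : n - r + k <= n by have := ltn_ord k; move: rn; clear; lia.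
rewrite -(big_mkord xpredT (fun q : nat => (k <= q < n - r + k) : nat)) (big_cat_nat (n := k)) //=; last first.
  by have := ltn_ord k; move: rn; clear; lia.
rewrite big_nat big1 ?add0n => [|j hj]; last by rewrite leqNgt; case/andP: hj => _ ->.
rewrite (big_cat_nat (n := n - r + k)) ?leq_addl //= [X in _ + X]big_nat [X in _ + X]big1 ?addn0 => [|j hj].
  rewrite big_nat (eq_bigr (fun=> 1)) => [|j -> //].
  by rewrite -big_nat sum_nat_const_nat muln1 addnK.
by case/andP: hj => hj _; rewrite ltnNge hj andbF.
Qed.

End Uniform.
(** * Interior and exterior of a necklace *)

Section Necklace.
Variables (n r : nat) (N : 'I_n -> {set 'I_n}).
Implicit Types (i j k l m p s u v x y z : 'I_n) (X Y : {set 'I_n}).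
Hypothesis neck : necklace r N.

Lemma posB s k z : pos s k <= pos s z /\ pos k z + pos s k = pos s z \/
  pos s z < pos s k /\ pos k z + pos s k = pos s z + n.
Proof.
have := pos_shift s k z; have := pos_shift k s s; have := pos_shift s k k; rewrite !pos_self.
have := pos_lt s z; have := pos_lt k z; have := pos_lt s k; have := pos_lt k s.
by clear; do 3 case: ifP; lia.
Qed.

(** Along the necklace an element can be lost only at its own index. *)
Lemma neck_keep s k l z : z \in N k -> pos s k <= pos s l -> pos s l <= pos s z -> z \in N l.
Proof.
case: neck => _ _ sub zk kl lz; have n0 := ord_gt0 k.
have {kl lz} : pos k l <= pos k z.
  have := posB s k l; have := posB s k z; have := pos_lt s z; have := pos_lt k z.
  by move: kl lz; clear; lia.
rewrite -{2}(posK k l); elim: (pos k l) => [|d IH] dz.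
  suff -> : at_pos k 0 = k by [].
  by apply: (@pos_inj _ k); rewrite pos_self at_posK.
have := subsetP (sub (at_pos k d)) z; rewrite !inE IH ?(ltnW dz) // andbT.
have dn : d.+1 < n := leq_ltn_trans dz (pos_lt k z).
have -> : ordS (at_pos k d) = at_pos k d.+1.
  by apply: val_inj; rewrite /= -addn1 modnDml addn1 addnS.
by apply; apply: contraTneq dz => ->; rewrite at_posK ?ltnn // ltnW.
Qed.

(** Read from [i], an element lost on the way from [i] to [j] lies before [j], and one lost on the
    way from [j] back to [i] lies at [j] or after it. *)
Lemma neck_before i j : cyc_before i (N i) (N j).
Proof.
apply/cyc_beforeP => x y; rewrite !inE => /andP[xj xi] /andP[yi yj].
have hx : pos i x < pos i j.
  by rewrite ltnNge; apply: contra xj => h; apply: (neck_keep xi (s := i)) => //; rewrite pos_self.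
have hy : pos j y < pos j i.
  by rewrite ltnNge; apply: contra yi => h; apply: (neck_keep yj (s := j)) => //; rewrite pos_self.
have := posB j i y; have := posB j i j; have := posB i j y; rewrite !pos_self.
by have := pos_lt j y; have := pos_lt i y; move: hx hy; clear; lia.
Qed.

Lemma pos_succ i k z : pos i k = 1 -> z != i -> pos i z = (pos k z).+1.
Proof.
move=> ik zi; have := posB i k z; have := pos_gt0 zi; rewrite ik; have := pos_lt i z.
by clear; lia.
Qed.

Lemma neck_step i k : pos i k = 1 -> exists2 j, j \notin N i :\ i & N k = j |: (N i :\ i).
Proof.
case: neck => Ni Nr _ ik.
have sub : N i :\ i \subset N k.
  apply/subsetP => z; rewrite !inE => /andP[zi zN].
  by apply: (neck_keep zN (s := i)); rewrite ?ik ?pos_self ?pos_gt0.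
have /cards1P[j e] : #|N k :\: (N i :\ i)| == 1.
  have := cardsD1 i (N i); have := cardsID (N i :\ i) (N k); rewrite (setIidPr sub) !Nr Ni.
  by move=> <- /eqP; rewrite addnC eqn_add2r.
exists j; first by have := set11 j; rewrite -e inE => /andP[].
by rewrite -(setID (N k) (N i :\ i)) (setIidPr sub) e setUC.
Qed.

(** * An interior set against a set separated from the necklace *)

Section Exterior.
Variables X Y : {set 'I_n}.
Hypothesis Xr : #|X| = r.
Hypothesis Yr : #|Y| = r.
Hypothesis Xin : forall i, cyc_before i (N i) X.
Hypothesis Ysep : forall i, ~ cross (N i) Y.

Local Notation good i := (cyc_before i (N i) Y).

Lemma card_diff_eq i : #|N i :\: Y| = #|Y :\: N i|.
Proof.
case: neck => _ Nr _; have := cardsID Y (N i); rewrite Nr -Yr -(cardsID (N i) Y) setIC.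
by move/eqP; rewrite eqn_add2l => /eqP.
Qed.

Lemma other_diff i x y y' : x \in N i :\: Y -> y \in Y :\: N i -> y' \in Y :\: N i -> y != y' ->
  exists2 x', x' \in N i :\: Y & x' != x.
Proof.
move=> hx hy hy' yy.
have : 0 < #|(N i :\: Y) :\ x|.
  have := cardsD1 x (N i :\: Y); rewrite hx card_diff_eq (cardsD1 y (Y :\: N i)) hy (cardsD1 y' (_ :\ y)).
  by rewrite in_setD1 eq_sym yy hy' !add1n => -[<-].
by case/card_gt0P => x'; rewrite in_setD1 => /andP[]; exists x'.
Qed.

Lemma other_diff' i y x x' : y \in Y :\: N i -> x \in N i :\: Y -> x' \in N i :\: Y -> x != x' ->
  exists2 y', y' \in Y :\: N i & y' != y.
Proof.
move=> hy hx hx' xx.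
have : 0 < #|(Y :\: N i) :\ y|.
  have := cardsD1 y (Y :\: N i); rewrite hy -card_diff_eq (cardsD1 x (N i :\: Y)) hx (cardsD1 x' (_ :\ x)).
  by rewrite in_setD1 eq_sym xx hx' !add1n => -[<-].
by case/card_gt0P => y'; rewrite in_setD1 => /andP[]; exists y'.
Qed.

(** If [c] were bad, every element from [b] up to [c] would lie in [N c], since one outside would
    make [c] good by [ncross_before]. As [b] is missing from [X], the interior condition at [c] then
    leaves [X] no element outside [N c]. So [X = N c] would contain [b]. *)
Lemma good_after b c : b \in Y :\: X -> c \notin Y ->
  (forall z, pos b z < pos b c -> z \in Y) -> good c.
Proof.
case: neck => Ni Nr _; rewrite inE => /andP[bX bY] cY bc; apply/negPn/negP => bad.
have cb : c != b by apply: contraNneq cY => ->.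
have tail z : pos c b <= pos c z -> pos b z < pos b c.
  have := posB c b z; have := posB c b c; rewrite pos_self; have := pos_lt c z; have := pos_lt b z.
  have := pos_gt0 cb; have : 0 < pos c b by apply: pos_gt0; rewrite eq_sym.
  by clear; lia.
have bN z : pos c b <= pos c z -> z \in N c.
  move=> h; apply/negPn/negP => zN; case/negP: bad; apply: ncross_before => //.
    by rewrite inE cY Ni.
  exists z; first by rewrite inE zN bc ?tail.
  move=> x; rewrite inE => /andP[xY xN]; rewrite ltnNge; apply: contra xY => h'.
  by apply: bc; apply: tail; apply: leq_trans h h'.
have XN : X = N c.
  apply/eqP; rewrite eqEcard Nr Xr leqnn andbT; apply/subsetP => x xX.
  apply/negPn/negP => xN; have /cyc_beforeP/(_ b x) := Xin c.
  rewrite !inE bX bN // xX xN => /(_ isT isT) /ltnW /bN xN'.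
  by rewrite xN' in xN.
by move: bX; rewrite XN bN.
Qed.

Lemma bad_pair k : ~~ good k ->
  exists x y, [/\ x \in N k :\: Y, y \in Y :\: N k & pos k y < pos k x].
Proof.
rewrite /cyc_before negb_forall_in => /exists_inP[x hx].
rewrite negb_forall_in => /exists_inP[y hy]; rewrite cyc_ltE -leqNgt => h.
exists x, y; split=> //; rewrite ltn_neqAle h andbT; apply: pos_neq.
by rewrite eq_sym; exact: setD_neq hx hy.
Qed.

(** The step sends [i] from first to last place and brings in [j], so the inversion at [k] has to
    use [j]. If [i] were in [Y], or an element of [Y] outside [N i] came after [j], equality of
    sizes would supply a further element of [N i] outside [Y] and a crossing with [N k]. *)
Lemma good_to_bad i k : pos i k = 1 -> good i -> ~~ good k ->
  i \notin Y /\ exists j, [/\ j \in N k, j \notin Y & forall y, y \in Y -> y \notin N i -> pos k y < pos k j].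
Proof.
case: neck => Ni Nr _ ik gi bk.
have [j jN kE] := neck_step ik.
have mem z : (z \in N k) = (z == j) || (z != i) && (z \in N i) by rewrite kE !inE.
have gi' := (cyc_beforeP i (N i) Y gi).
have g x y : x \in N i -> x \notin Y -> y \in Y -> y \notin N i -> pos i x < pos i y.
  by move=> h1 h2 h3 h4; apply: gi'; rewrite inE ?h1 ?h2 ?h3 ?h4.
have [x [y [hx hy yx]]] := bad_pair bk.
have sh z : z != i -> pos i z = (pos k z).+1 by exact: pos_succ.
have ki : pos k i = n.-1.
  by have := posB i k i; rewrite pos_self ik; have := pos_lt k i; clear; lia.
have last z : z != i -> pos k z < pos k i.
  by move=> zi; have := sh _ zi; have := pos_lt i z; rewrite ki; clear; lia.
move: (hx) (hy); rewrite !inE => /andP[xY xk] /andP[yk yY].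
have ix : x != i -> y != i -> x = j.
  move=> xi yi; move: (xk); rewrite mem => /orP[/eqP//|/andP[_ xN]].
  have yN : y \notin N i by move: yk; rewrite mem yi negb_or => /andP[].
  have := g x y xN xY yY yN; rewrite !sh // ltnS => h.
  by move: yx; rewrite ltnNge ltnW.
have low x' : x' \in N i :\: Y -> x' != i -> y != i -> x' \in N k :\: Y /\ pos k x' < pos k y.
  rewrite inE => /andP[xY' xN'] xi' yi; rewrite inE xY' mem xi' xN' orbT; split=> //.
  have yN : y \notin N i by move: yk; rewrite mem yi negb_or => /andP[].
  by have := g x' y xN' xY' yY yN; rewrite !sh.
have iY : i \notin Y.
  apply/negP => iY; have xi : x != i by apply: contraNneq xY => ->.
  have yi : y != i.
    by apply: contraTneq yx => ->; rewrite -leqNgt ltnW // last.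
  have xj := ix xi yi.
  have yN : y \in Y :\: N i by rewrite inE yY; move: yk; rewrite mem yi negb_or => /andP[_ ->].
  have /card_gt0P[x' hx'] : 0 < #|N i :\: Y| by rewrite card_diff_eq (cardD1 y) yN.
  have xi' : x' != i by apply: contraTneq hx' => ->; rewrite inE iY.
  have [hx'' lt] := low x' hx' xi' yi.
  suff: cross (N k) Y by exact: Ysep.
  apply: (cross_base hx'' hy hx _ lt yx (last x xi)).
  by rewrite inE iY mem eqxx /= orbF andbT -xj eq_sym.
have yi : y != i by apply: contraNneq iY => <-.
have xj : x = j.
  have [xi|/ix->//] := eqVneq x i.
  by move: xk; rewrite mem xi eqxx orbF => /eqP->.
split=> //; exists j; rewrite -xj; split=> // y' yY' yN'.
rewrite ltnNge leq_eqVlt; apply/negP => /orP[/eqP/pos_inj e|lt]; first by rewrite e yY' in xY.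
have xi : x != i.
  apply: contraTneq lt => ->; rewrite -leqNgt; have [->//|/last/ltnW] := eqVneq y' i; exact.
have yk' : y' \in Y :\: N k.
  by rewrite inE yY' mem (negbTE yN') andbF orbF andbT -xj; apply: contraNneq xY => <-.
have iN : i \in N i :\: Y by rewrite inE iY Ni.
have yN : y \in Y :\: N i by rewrite inE yY; move: yk; rewrite mem yi negb_or => /andP[_ ->].
have yyn : y != y' by apply: contraTneq (ltn_trans yx lt) => ->; rewrite ltnn.
have yN2 : y' \in Y :\: N i by rewrite inE yN'.
have [x' hx' xi'] := other_diff iN yN yN2 yyn.
have [hx'' lt'] := low x' hx' xi' yi.
exact: (Ysep (cross_base hx'' hy hx yk' lt' yx lt)).
Qed.

(** The mirror situation: the inversion at [p] must disappear, so its element of [Y] is the entering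
    [j]. Any violation of the conclusion would supply a further element of [Y] and a crossing with
    [N p]. *)
Lemma bad_to_good p m : pos p m = 1 -> ~~ good p -> good m ->
  exists j, [/\ j \in N m, j \in Y, j \notin N p &
    forall x, x \in N m -> x \notin Y -> pos m j < pos m x].
Proof.
case: neck => Ni Nr _ pm bp gm.
have [j jN mE] := neck_step pm.
have mem z : (z \in N m) = (z == j) || (z != p) && (z \in N p) by rewrite mE !inE.
have gm' := (cyc_beforeP m (N m) Y gm).
have [x [y [hx hy yx]]] := bad_pair bp.
have sh z : z != p -> pos p z = (pos m z).+1 by exact: pos_succ.
move: (hx) (hy); rewrite !inE => /andP[xY xp] /andP[yp yY].
have yp' : y != p by apply: contraNneq yp => ->.
have xp' : x != p by apply: contraTneq yx => ->; rewrite pos_self.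
have xm : x \in N m :\: Y by rewrite inE xY mem xp' xp orbT.
have yx' : pos m y < pos m x by move: yx; rewrite !sh.
have yj : y = j.
  apply/eqP/negPn/negP => yj; have := gm' x y xm.
  rewrite inE yY mem (negbTE yj) (negbTE yp) andbF => /(_ isT).
  by rewrite ltnNge ltnW.
have far y' : y' \in Y :\: N p -> y' != j -> pos m x < pos m y'.
  rewrite inE => /andP[yN' yY'] yj'; apply: gm' => //.
  by rewrite inE yY' mem (negbTE yj') (negbTE yN') andbF.
have hj : j \in Y :\: N p by rewrite -yj.
have pY : p \in Y.
  apply/negPn/negP => pY; have pN : p \in N p :\: Y by rewrite inE pY Ni.
  have px : p != x by rewrite eq_sym.
  have [y' hy' yj'] := other_diff' hj pN hx px.
  have xy' := far y' hy' yj'.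
  have yp2 : y' != p by apply: contraTneq hy' => ->; rewrite inE Ni.
  apply: (Ysep (cross_base (i := p) pN hy hx hy' _ yx _)); first by rewrite pos_self pos_gt0.
  by rewrite !sh.
exists j; rewrite -yj; split=> //; first by rewrite mem yj eqxx.
move=> z zm zY; rewrite ltnNge leq_eqVlt; apply/negP => /orP[/eqP/pos_inj e|lt].
  by rewrite e yY in zY.
have zp : z != p by apply: contraNneq zY => ->.
have zj : z != j by rewrite -yj; apply: contraNneq zY => ->.
have hz : z \in N p :\: Y by rewrite inE zY; move: zm; rewrite mem (negbTE zj) => /andP[].
have zx : z != x by apply: contraTneq (ltn_trans lt yx') => ->; rewrite ltnn.
have [y' hy' yj'] := other_diff' hj hz hx zx.
have yp2 : y' != p by apply: contraTneq hy' => ->; rewrite inE Ni.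
exact: (Ysep (cross_base hz hy hx hy' lt yx' (far y' hy' yj'))).
Qed.

Lemma bad_ncross k : ~~ good k -> ~ cross X Y.
Proof.
case: neck => Ni Nr _ bk [w [x [y [z [hw hx hy hz o]]]]].
have first_out b c : c \notin Y -> exists c', [/\ c' \notin Y, pos b c' <= pos b c &
    forall u, pos b u < pos b c' -> u \in Y].
  move=> cY; case: (@arg_minnP _ c (fun c => c \notin Y) (pos b) cY) => c' cY' mn.
  exists c'; split=> // [|u]; first exact: mn.
  by apply: contraTT => /mn; rewrite leqNgt.
have after b c : b \in Y :\: X -> c \notin Y -> exists2 c', good c' & pos b c' <= pos b c.
  by move=> hb /(first_out b)[c' [cY' le out]]; exists c' => //; exact: good_after hb cY' out.
have notY u : u \in X :\: Y -> u \notin Y by rewrite inE => /andP[].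
have [g0 gg0 _] := after x w hx (notY _ hw).
(* [i] is the last good index before [k], so the bad run starts at its successor [s]; below, [m] is
   the first good index after the run and [p] its last index. Positions are read from [s], where [i]
   comes last. *)
case: (@arg_minnP _ g0 (fun g => good g) (fun g => pos g k) gg0) => i gi imin.
have ki : k != i by apply: contraNneq bk => ->.
have ik0 := pos_gt0 ki.
have n1 : 1 < n := leq_ltn_trans ik0 (pos_lt i k).
pose s := at_pos i 1.
have is1 : pos i s = 1 by rewrite at_posK.
have bs : ~~ good s.
  apply/negP => /imin; have := posB i s k; rewrite is1; have := pos_lt s k.
  by move: ik0; clear; lia.
have si : pos s i = n.-1.
  by have := posB i s i; rewrite pos_self is1; have := pos_lt s i; clear; lia.
case: (@arg_minnP _ i (fun g => good g) (fun g => pos s g) gi) => m gm mmin.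
have run u : pos s u < pos s m -> ~~ good u.
  by rewrite ltnNge; apply: contra; exact: mmin.
have m0 : 0 < pos s m by apply: pos_gt0; apply: contraNneq bs => <-.
pose p := at_pos s (pos s m).-1.
have sp : pos s p = (pos s m).-1.
  by rewrite at_posK // (leq_ltn_trans (leq_pred _)) // pos_lt.
have pm : pos p m = 1.
  by have := posB s p m; rewrite sp; have := pos_lt p m; move: m0; clear; lia.
have bp : ~~ good p by apply: run; rewrite sp prednK.
have [iY [j [js jY jlast]]] := good_to_bad is1 gi bs.
have [q [qm qY qp qfirst]] := bad_to_good pm bp gm.
have mid u v : pos s m <= pos s u -> (pos m u < pos m v) = (pos s u < pos s v) || (pos s v < pos s m).
  have := posB s m u; have := posB s m v; have := pos_lt m u; have := pos_lt m v.
  have := pos_lt s u; have := pos_lt s v; clear.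
  by case: (ltnP (pos s u) (pos s v)); case: (ltnP (pos s v) (pos s m)); lia.
have lastI u : u != i -> pos s u < pos s i.
  by move=> ui; have := pos_succ is1 ui; have := pos_lt i u; rewrite si; clear; lia.
have keepI u l : u \in N i -> u != i -> pos s l <= pos s u -> u \in N l.
  move=> uN ui lu; apply: (neck_keep uN (s := i)); rewrite ?pos_self //.
  have [->|li] := eqVneq l i; first by rewrite pos_self.
  by rewrite !(pos_succ is1).
(* [alpha] and [beta] enclose [Y], on the arc from [m] on, between [N i] without [i] and [N m]. *)
have alpha u : u \in N i -> u != i -> pos s m <= pos s u -> u \in Y.
  move=> uN ui mu; apply/negPn/negP => uY.
  have um := keepI _ _ uN ui mu; have := qfirst u um uY => qu.
  have mq : pos s m <= pos s q.
    rewrite leqNgt; apply/negP => h; have := posB s m q; have := posB s m u.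
    by have := pos_lt s u; move: h mu qu; clear; lia.
  rewrite mid // ltnNge in qu; case/orP: qu => qu; last by rewrite leqNgt qu in mu.
  have qi : q != i by apply: contraNneq iY => <-.
  have qN : q \notin N i.
    by apply: contra qp => qN; apply: keepI => //; rewrite sp; move: mq; clear; lia.
  have := cyc_beforeP i (N i) Y gi u q; rewrite !inE uY uN qY qN => /(_ isT isT).
  by rewrite !(pos_succ is1) // ltnS => h; case/negP: qu; exact: ltnW.
have beta u : u \in Y -> pos s m <= pos s u -> u \in N m.
  move=> uY mu; apply/negPn/negP => uN.
  have ui : u != i by apply: contraNneq iY => <-.
  have uNi : u \notin N i by apply: contra uN => uN; exact: keepI.
  have uj := jlast u uY uNi; have mj : pos s m <= pos s j := leq_trans mu (ltnW uj).
  have jm : j \in N m by apply: (neck_keep js (s := s)); rewrite ?pos_self.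
  have := cyc_beforeP m (N m) Y gm j u; rewrite !inE jm jY uY uN => /(_ isT isT).
  by rewrite mid // ltnNge (ltnW uj) ltnNge mu.
(* If [b] came first, [good_after] would produce a good index between [b] and [c], inside the
   run. *)
have runXY b c : b \in Y :\: X -> c \in X :\: Y -> pos s c < pos s m -> pos s c < pos s b.
  move=> hb hc cm; rewrite ltnNge; apply/negP => bc.
  have [c' gc' le] := after b c hb (notY _ hc); suff: ~~ good c' by rewrite gc'.
  apply: run.
  have := posB s b c; have := posB s b c'; have := pos_lt s c'; have := pos_lt s c.
  by move: bc le cm; clear; lia.
have tailXY b c : b \in Y :\: X -> c \in X :\: Y -> pos s m <= pos s c -> pos s b < pos s m \/ pos s b < pos s c.
  rewrite !inE => /andP[bX bY] /andP[cY cX] mc.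
  have [mb|] := leqP (pos s m) (pos s b); last by left.
  right; rewrite ltnNge leq_eqVlt; apply/negP => /orP[/eqP/pos_inj e|cb]; first by rewrite e bY in cY.
  have bi : b != i by apply: contraNneq iY => <-.
  have ci : c != i by apply: contraTneq cb => ->; rewrite -leqNgt ltnW // lastI.
  have cNi : c \notin N i by apply: contra cY => cN; exact: alpha.
  have NX l u v : u \in N l -> u \notin X -> v \in X -> v \notin N l -> pos l u < pos l v.
    by move=> h1 h2 h3 h4; apply: (cyc_beforeP l (N l) X (Xin l)); rewrite inE ?h1 ?h2 ?h3 ?h4.
  have bNi : b \notin N i.
    apply/negP => bN; have := NX i b c bN bX cX cNi; rewrite !(pos_succ is1) // ltnS.
    by rewrite ltnNge ltnW.
  have bm := beta b bY mb.
  have both_in l : pos s l <= pos s m -> b \in N l -> c \in N l.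
    move=> lm bN; apply/negPn/negP => cN; have := NX l b c bN bX cX cN.
    have := posB s l b; have := posB s l c; move: lm mb mc cb; clear; lia.
  have cm := both_in m (leqnn _) bm.
  (* Both [b] and [c] are missing from [N i] and present in [N m], and [c] is present whenever [b]
     is. As one step brings in only one element, [c] enters strictly before [b]. *)
  have [l [lm cl bl]] : exists l, [/\ pos s l <= pos s m, c \in N l & b \notin N l].
    case: (@arg_minnP _ m (fun l => c \in N l) (pos s) cm) => l cl lmin.
    have lm : pos s l <= pos s m by exact: lmin.
    exists l; split=> //; apply/negP => bl.
    have li : l != i by apply: contraTneq cl => ->.
    pose l' := at_pos i (pos i l).-1; have il := pos_gt0 li.
    have il' : pos i l' = (pos i l).-1.
      by rewrite at_posK // (leq_ltn_trans (leq_pred _)) // pos_lt.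
    have ll : pos l' l = 1.
      by have := posB i l' l; rewrite il'; have := pos_lt l' l; move: il; clear; lia.
    have [t tN lE] := neck_step ll.
    have cl' : c \notin N l'.
      have [ls|ls] := eqVneq l s.
        suff -> : l' = i by [].
        by apply: (@pos_inj _ i); rewrite il' ls is1 pos_self.
      have ls0 := pos_gt0 ls.
      apply/negP => /lmin; have := posB i s l; have := posB i s l'; rewrite is1 il'.
      have := pos_lt s l; have := pos_lt s l'; move: ls0 il; clear; lia.
    have bl' : b \notin N l'.
      apply: contra cl' => bN; have [li'|li'] := eqVneq l' i; first by rewrite li' (negbTE bNi) in bN.
      apply: both_in => //; apply: leq_trans lm.
      by rewrite -ltnS -!(pos_succ is1) // il' leq_pred.
    move: cl bl; rewrite lE !inE (negbTE cl') (negbTE bl') !andbF !orbF => /eqP ct /eqP bt.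
    by rewrite ct -bt ltnn in cb.
  have mq : pos s m <= pos s q /\ pos s q < pos s c.
    have := qfirst c cm cY; have := posB s m q; have := posB s m c.
    by have := pos_lt s c; have := pos_lt s q; move: mc; clear; lia.
  have ql : q \notin N l.
    apply: contra qp => ql; apply: (neck_keep ql (s := s)).
      rewrite sp -ltnS prednK // ltn_neqAle lm andbT; apply/eqP => /pos_inj e.
      by rewrite e bm in bl.
    by rewrite sp; case: mq => h _; move: h; clear; lia.
  have bj := jlast b bY bNi.
  have jl : j \in N l.
    apply: (neck_keep js (s := s)); rewrite ?pos_self //.
    exact: leq_trans (leq_trans lm mb) (ltnW bj).
  (* At this [l] the points [q], [c], [b], [j] lie alternately in [Y] only and in [N l] only. *)
  suff: cross (N l) Y by exact: Ysep.
  apply: cross_sym.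
  by apply: (@cross_base _ s _ _ q c b j); rewrite ?inE ?ql ?cl ?bl ?jl ?qY ?cY ?bY ?jY ?(proj2 mq).
have [rxw rxy] := (runXY x w hx hw, runXY x y hx hy).
have [rzw rzy] := (runXY z w hz hw, runXY z y hz hy).
have [txw txy] := (tailXY x w hx hw, tailXY x y hx hy).
have [tzw tzy] := (tailXY z w hz hw, tailXY z y hz hy).
move: rxw rxy rzw rzy txw txy tzw tzy o; have := posB s w x; have := posB s w y; have := posB s w z.
have := pos_lt s w; have := pos_lt s x; have := pos_lt s y; have := pos_lt s z.
have := pos_neq s (setD_neq hw hx).
by clear; lia.
Qed.

End Exterior.
End Necklace.
(** * The four pieces *)

Section Pieces.
Variables (n r : nat).
Hypothesis n0 : 0 < n.
Implicit Types (E F X Y : {set 'I_n}) (N : 'I_n -> {set 'I_n}) (A D : {set {set 'I_n}}).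

Lemma separated_refl X : separated X X.
Proof. by apply/existsP; exists (Ordinal n0); apply/cyc_beforeP => x y; rewrite setDv in_set0. Qed.

Lemma separated_systemP A :
  reflect (forall E F, E \in A -> F \in A -> separated E F) (separated_system A).
Proof.
apply: (iffP forall_inP) => [h E F EA FA|h E EA]; first by have /forall_inP := h E EA; apply.
by apply/forall_inP => F; exact: h.
Qed.

Lemma max_separatedP D A : max_separated_in D A -> [/\ A \subset D,
  forall E F, E \in A -> F \in A -> separated E F &
  forall X, X \in D -> (forall E, E \in A -> separated X E) -> X \in A].
Proof.
move=> /maxsetP[/andP[AD /separated_systemP sA] mx]; split=> // X XD sX.
rewrite -(mx (X |: A)) ?setU11 ?subsetUr // subUset sub1set XD AD /=.
apply/separated_systemP => E F; rewrite !inE => /orP[/eqP->|EA] /orP[/eqP->|FA].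
- exact: separated_refl.
- exact: sX.
- by apply: separated_sym; exact: sX.
exact: sA.
Qed.

Lemma max_separated_exists D : exists A, max_separated_in D A.
Proof.
have : exists A, (A \subset D) && separated_system A; last by case/ex_maxset => A; exists A.
exists set0; rewrite sub0set; by apply/separated_systemP => E F; rewrite in_set0.
Qed.

Lemma interior_sub N : interior r N \subset separated_from r N.
Proof.
apply/subsetP => X; rewrite !inE => /andP[-> /forallP h] /=.
by apply/forallP => i; apply: separated_sym; apply/existsP; exists i.
Qed.

Lemma neck_interior N i : necklace r N -> N i \in interior r N.
Proof.
move=> nk; rewrite inE; case: (nk) => _ -> _; rewrite eqxx.
by apply/forallP => j; exact: neck_before nk j i.
Qed.

Lemma interior_exterior N X Y : necklace r N -> X \in interior r N -> Y \in exterior r N ->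
  separated X Y.
Proof.
move=> nk; rewrite !inE => /andP[/eqP Xr /forallP Xin] /andP[+ /andP[/eqP Yr /forallP sY]].
rewrite Yr eqxx => /forallPn[k bk]; apply/(separatedP _ _ n0).
by apply: (bad_ncross nk Xr Yr Xin _ bk) => i; apply/separated_ncross/separated_sym.
Qed.

End Pieces.

Definition side n r (N : 'I_n -> {set 'I_n}) (s : bool) :=
  if s then interior r N else exterior r N.

Section Quadrants.
Variables (n r : nat) (N1 N2 : 'I_n -> {set 'I_n}).
Hypothesis n0 : 0 < n.
Hypothesis nk1 : necklace r N1.
Hypothesis nk2 : necklace r N2.
Hypothesis N12 : forall i j, separated (N1 i) (N2 j).

Let piece s t := side r N1 s :&: side r N2 t.

Lemma side_in (N : 'I_n -> {set 'I_n}) s X : X \in side r N s -> (X \in interior r N) = s.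
Proof. by case: s => //=; rewrite inE => /andP[/negbTE]. Qed.

Lemma side_separated (N : 'I_n -> {set 'I_n}) s X i : X \in side r N s -> separated X (N i).
Proof.
have h : X \in separated_from r N -> separated X (N i) by rewrite inE => /andP[_ /forallP].
by case: s => /= [/(subsetP (interior_sub _ _))|]; [exact: h|rewrite inE => /andP[_ /h]].
Qed.

Lemma in_side (N : 'I_n -> {set 'I_n}) X : X \in separated_from r N ->
  X \in side r N (X \in interior r N).
Proof. by case E: (X \in interior r N) => //= XS; rewrite inE E. Qed.

Lemma side_card (N : 'I_n -> {set 'I_n}) s X : X \in side r N s -> #|X| = r.
Proof.
have h : X \in separated_from r N -> #|X| = r by rewrite inE => /andP[/eqP].
by case: s => /= [/(subsetP (interior_sub _ _))|]; [exact: h|rewrite inE => /andP[_ /h]].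
Qed.

Lemma side_neq (N : 'I_n -> {set 'I_n}) s t X Y : necklace r N -> X \in side r N s ->
  Y \in side r N t -> s != t -> separated X Y.
Proof.
move=> nk; case: s; case: t => //= hX hY _; first exact: interior_exterior hX hY.
by apply: separated_sym; exact: interior_exterior hY hX.
Qed.

Lemma card_quadrants (A : bool -> bool -> {set {set 'I_n}}) :
  (forall s t, max_separated_in (piece s t) (A s t)) ->
  #|A true true| + #|A true false| + #|A false true| + #|A false false| = r * (n - r) + 1.
Proof.
move=> mA.
have AP s t E : E \in A s t -> E \in side r N1 s /\ E \in side r N2 t.
  by have [/subsetP sub _ _] := max_separatedP n0 (mA s t); move/sub; rewrite inE => /andP[].
have Amem s t E : E \in A s t -> (E \in interior r N1) = s /\ (E \in interior r N2) = t.
  by move/AP=> [/side_in-> /side_in->].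
(* The union of the four systems, with each set looked up in the only piece that can contain it. *)
pose U := [set E | E \in A (E \in interior r N1) (E \in interior r N2)].
have UP E : E \in U -> exists s t, E \in A s t.
  by rewrite inE; exists (E \in interior r N1), (E \in interior r N2).
have AU s t E : E \in A s t -> E \in U by move=> EA; rewrite inE; have [-> ->] := Amem _ _ _ EA.
have -> : #|A true true| + #|A true false| + #|A false true| + #|A false false| = #|U|.
  have part (V : {set {set 'I_n}}) s t : (forall E, (E \in V) =
      [&& E \in U, (E \in interior r N1) == s & (E \in interior r N2) == t]) -> #|A s t| = #|V|.
    move=> h; apply: eq_card => E; rewrite h; apply/idP/and3P => [EA|[+ /eqP e1 /eqP e2]].
      by have [-> ->] := Amem _ _ _ EA; rewrite !eqxx (AU s t).
    by rewrite inE e1 e2.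
  rewrite -(cardsID (interior r N1) U) -(cardsID (interior r N2) (U :&: _)).
  rewrite -(cardsID (interior r N2) (U :\: _)) !addnA.
  congr (_ + _ + _ + _); apply: part => E; rewrite !(in_setI, in_setD);
    by case: (E \in U); case: (E \in interior r N1); case: (E \in interior r N2).
have [_ N1r _] := nk1; have rn : r <= n.
  by rewrite -(N1r (Ordinal n0)) -[X in _ <= X]card_ord max_card.
(* A member of a necklace is separated from everything in its piece, so maximality puts it into [U].
   Consequently any r-set separated from [U] belongs to one of the pieces. *)
have N1U i : N1 i \in U.
  have h1 : N1 i \in interior r N1 by exact: neck_interior.
  have h2 : N1 i \in separated_from r N2 by rewrite inE N1r eqxx; apply/forallP.
  have [_ _ mx] := max_separatedP n0 (mA true (N1 i \in interior r N2)).
  apply: (AU true (N1 i \in interior r N2)); apply: mx; first by rewrite inE h1 in_side.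
  by move=> E /AP[hE _]; apply: separated_sym; exact: side_separated hE.
have [_ N2r _] := nk2.
have N2U i : N2 i \in U.
  have h2 : N2 i \in interior r N2 by exact: neck_interior.
  have h1 : N2 i \in separated_from r N1.
    by rewrite inE N2r eqxx; apply/forallP => j; exact: separated_sym.
  have [_ _ mx] := max_separatedP n0 (mA (N2 i \in interior r N1) true).
  apply: (AU (N2 i \in interior r N1) true); apply: mx; first by rewrite inE h2 in_side.
  by move=> E /AP[_ hE]; apply: separated_sym; exact: side_separated hE.
apply: card_maximal => //.
- move=> E F /UP[s [t EA]] /UP[s' [t' FA]]; apply: separated_ncross.
  have [E1 E2] := AP _ _ _ EA; have [F1 F2] := AP _ _ _ FA.
  have [ss|ss] := eqVneq s s'; last exact: (side_neq nk1 E1 F1 ss).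
  have [tt|tt] := eqVneq t t'; last exact: (side_neq nk2 E2 F2 tt).
  by have [_ sA _] := max_separatedP n0 (mA s t); apply: sA => //; rewrite ss tt.
- by move=> E /UP[s [t /AP[/side_card]]].
move=> X Xr nc; have sX E : E \in U -> separated X E by move=> EU; apply/(separatedP _ _ n0)/nc.
have X1 : X \in separated_from r N1 by rewrite inE Xr eqxx; apply/forallP => i; exact: sX (N1U i).
have X2 : X \in separated_from r N2 by rewrite inE Xr eqxx; apply/forallP => i; exact: sX (N2U i).
have [_ _ mx] := max_separatedP n0 (mA (X \in interior r N1) (X \in interior r N2)).
rewrite inE; apply: mx; first by rewrite inE !in_side.
by move=> E /AU; exact: sX.
Qed.

(** With maximal systems fixed in the other three pieces, the total is the same for either choice in
    this one. *)
Lemma pure_quadrant s t : pure (piece s t).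
Proof.
move=> A B mA mB.
pose M s t := xchoose (max_separated_exists (piece s t)).
have mM s' t' : max_separated_in (piece s' t') (M s' t') by exact: xchooseP.
pose upd (V : {set {set 'I_n}}) s' t' := if (s' == s) && (t' == t) then V else M s' t'.
have mupd V : max_separated_in (piece s t) V ->
    forall s' t', max_separated_in (piece s' t') (upd V s' t').
  by move=> mV s' t'; rewrite /upd; case: ifP => [/andP[/eqP-> /eqP->]|].
have := card_quadrants (mupd A mA); rewrite -(card_quadrants (mupd B mB)) /upd.
move: (s) (t) => [] [] /= /eqP; rewrite ?eqn_add2r ?eqn_add2l; by move/eqP.
Qed.

End Quadrants.

Theorem proposition4 (n r : nat) (N1 N2 : 'I_n -> {set 'I_n}) :
  1 <= n ->
  necklace r N1 ->
  necklace r N2 ->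
  (forall i j : 'I_n, separated (N1 i) (N2 j)) ->
  let I1 := interior r N1 in
  let I2 := interior r N2 in
  let O1 := exterior r N1 in
  let O2 := exterior r N2 in
  [/\ pure (I1 :&: I2), pure (I1 :&: O2), pure (O1 :&: I2), pure (O1 :&: O2)
    & rank (I1 :&: I2) + rank (I1 :&: O2) + rank (O1 :&: I2)
        + rank (O1 :&: O2) = r * (n - r) + 1].
Proof.
move=> n0 nk1 nk2 N12 I1 I2 O1 O2.
have pp := pure_quadrant n0 nk1 nk2 N12.
split; [exact: (pp true true)|exact: (pp true false)|exact: (pp false true)|exact: (pp false false)|].
pose M s t := xchoose (max_separated_exists (side r N1 s :&: side r N2 t)).
have mM s t : max_separated_in (side r N1 s :&: side r N2 t) (M s t) by exact: xchooseP.
have rk s t : rank (side r N1 s :&: side r N2 t) = #|M s t| by exact: rank_pure.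
rewrite -(card_quadrants n0 nk1 nk2 N12 mM) -!rk; reflexivity.
Qed.
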